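(* Assume that $w:\mathbb R\to(-\infty,0]$ satisfies Assumption (A) given in the context, with $\operatorname{supp}w=[-s_w,s_w]$, and that $w$ is additionally $C^2$ on $(-s_w,s_w)$. Fix $\gamma>0$ and $\ell\in(0,1/(2s_w))$. Let $\rho\in\mathcal P(\mathbb T)$ be a global minimiser of the free energy $$\mathcal F_{\gamma,\ell}(\rho)=\int_{[0,1]}\rho\log\rho\,dx+\frac12\iint_{[0,1]^2}W_{\gamma,\ell}(x-y)\rho(x)\rho(y)\,dx\,dy .$$ Then there exists a translation $T:\mathbb T\to\mathbb T$ such that $\rho=\rho^\ast\circ T$, where $\rho^\ast$ is the symmetric decreasing rearrangement of (the density of) $\rho$.
   Context: $\mathbb T\simeq[0,1)$ is the one-dimensional torus and $\mathcal P(\mathbb T)$ the set of Borel probability measures on it; an absolutely continuous measure is identified with its density, and $\mathcal F_{\gamma,\ell}(\rho)=+\infty$ if $\rho$ has no density or $\rho\log\rho$ is not integrable. Assumption (A) on $w:\mathbb R\to(-\infty,0]$: (i) $w$ is even, Lipschitz continuous, and non-decreasing on $[0,\infty)$; (ii) $w$ has compact support, there is $s_w\in[0,\infty)$ with $\operatorname{supp}w=[-s_w,s_w]$, and $w\le 0$; (iii) $w$ is $C^2$ in a neighbourhood of $0$ and attains its global minimum at $0$, with $w''(0)>0$. $W_{\gamma,\ell}(x):=\gamma\,\ell\,w(x/\ell)$ for $|x|<\tfrac12$, extended $1$-periodically to $\mathbb R$. Symmetric decreasing rearrangement: for measurable $f:\mathbb T\to[0,\infty)$, $f^\ast:\mathbb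 T\to[0,\infty)$ is the (unique up to null sets) measurable function that depends only on the geodesic distance $d(\cdot,0)$ to the point $0\in\mathbb T$, is non-increasing in that distance, and satisfies $|\{f^\ast>t\}|=|\{f>t\}|$ for all $t>0$. *)

(* Defs.v *)
From HB Require Import structures.
From mathcomp Require Import all_boot all_order all_algebra.
From mathcomp Require Import all_classical all_reals all_analysis.

Set Implicit Arguments.
Unset Strict Implicit.
Unset Printing Implicit Defensive.

Import Order.TTheory GRing.Theory Num.Theory.
Import numFieldNormedType.Exports.

Local Open Scope ring_scope.
Local Open Scope classical_set_scope.

(* The torus is represented by its fundamental domain `[0, 1[: points of the
   torus are the reals of `[0, 1[, and the values of a function or of a measure
   outside `[0, 1[ carry no information. *)

Definition torus {R : realType} : set R := `[0, 1[.

Definition frac {R : realType} (x : R) : R := x - (Num.floor x)%:~R.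

Definition torus_dist {R : realType} (x y : R) : R :=
  Num.min (frac (x - y)) (1 - frac (x - y)).

Definition torus_translation {R : realType} (a x : R) : R := frac (x + a).

(* Borel probability measures on the torus are the Borel probability measures
   on the line that are concentrated on `[0, 1[. *)
Definition torus_probability {R : realType}
    (P : probability (measurableTypeR R) R) : Prop :=
  P torus = 1%E.

(* The Radon-Nikodym derivative with respect to Lebesgue measure; it is
   meaningful, and everywhere nonnegative and finite, when
   P `<< lebesgue_measure. *)
Definition density {R : realType} (P : probability (measurableTypeR R) R) :
    R -> R :=
  fun x => fine (Radon_Nikodym_SigmaFinite.f P (@lebesgue_measure R) x).

(* Meant for open U, where the derivatives only depend on the values on U. *)
Definition C2_on {R : realType} (U : set R) (f : R -> R) : Prop :=
  forall x, U x -> [/\ derivable f x 1, derivable f^`() x 1 &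
                       {for x, continuous f^`(2)}].

Record assumptionA {R : realType} (w : R -> R) (sw : R) : Prop := AssumptionA {
  A_even : forall x, w (- x) = w x;
  A_lipschitz : exists k : R, k.-lipschitz w;
  A_nondecreasing : forall x y, 0 <= x -> x <= y -> w x <= w y;
  A_sw_ge0 : 0 <= sw;
  A_support : closure [set x | w x != 0] = `[- sw, sw];
  A_le0 : forall x, w x <= 0;
  A_C2 : exists2 U : set R, open_nbhs 0 U & C2_on U w;
  A_min : forall x, w 0 <= w x;
  A_curvature : 0 < w^`(2) 0 }.

(* The 1-periodic extension of x |-> gamma * l * w (x / l), |x| < 1/2: the
   argument is first brought into [-1/2, 1/2[.  The value at the points of
   1/2 + Z is that of the formula at -1/2. *)
Definition potential {R : realType} (w : R -> R) (gamma l : R) (x : R) : R :=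
  gamma * l * w ((x - (Num.floor (x + 2^-1))%:~R) / l).

(* At points where the density vanishes, the convention 0 * log 0 = 0 holds
   because ln 0 = 0. *)
Definition entropy_density {R : realType}
    (P : probability (measurableTypeR R) R) (x : R) : R :=
  density P x * ln (density P x).

Definition free_energy {R : realType} (w : R -> R) (gamma l : R)
    (P : probability (measurableTypeR R) R) : \bar R :=
  if `[< P `<< @lebesgue_measure R /\
         (@lebesgue_measure R).-integrable `[0%R, 1%R]
           (EFin \o entropy_density P) >] then
    (\int[@lebesgue_measure R]_(x in `[0%R, 1%R]) (entropy_density P x)%:E +
     (2^-1)%:E *
       \int[@lebesgue_measure R \x @lebesgue_measure R]_(z in
           `[0%R, 1%R] `*` `[0%R, 1%R])
         (potential w gamma l (z.1 - z.2) * density P z.1 * density P z.2)%:E)%E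
  else +oo%E.

Definition global_minimiser {R : realType} (w : R -> R) (gamma l : R)
    (P : probability (measurableTypeR R) R) : Prop :=
  torus_probability P /\
  forall Q : probability (measurableTypeR R) R, torus_probability Q ->
    (free_energy w gamma l P <= free_energy w gamma l Q)%E.

Definition is_rearrangement {R : realType} (f fs : R -> R) : Prop :=
  [/\ measurable_fun torus fs,
      forall x, torus x -> 0 <= fs x,
      forall x y, torus x -> torus y ->
        torus_dist x 0 = torus_dist y 0 -> fs x = fs y,
      forall x y, torus x -> torus y ->
        torus_dist x 0 <= torus_dist y 0 -> fs y <= fs x &
      forall t, 0 < t ->
        lebesgue_measure (torus `&` [set x | t < fs x]) =
        lebesgue_measure (torus `&` [set x | t < f x])].

(* Main.v *)
Require Import Defs.
From HB Require Import structures.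
From mathcomp Require Import all_boot all_order all_algebra.
From mathcomp Require Import all_classical all_reals all_analysis measurable_realfun.
From mathcomp Require Import ring lra.

Set Implicit Arguments.
Unset Strict Implicit.
Unset Printing Implicit Defensive.

Import Order.TTheory GRing.Theory Num.Theory.
Import numFieldNormedType.Exports.

Local Open Scope ring_scope.
Local Open Scope classical_set_scope.

Local Notation frac := Defs.frac.

(** Write [W] for the periodic potential and [pot W h] for its convolution with
    [h].  Instead of an analysis of the equality cases in the Riesz
    rearrangement inequality, the proof compares the minimiser with its
    polarizations (two-point symmetrisations) and exploits the Euler-Lagrange
    equation, which all the minimisers satisfy.

    - Moving a minimiser [rho] a little towards the Gibbs density
      [g = exp (- pot W rho) / Z] changes the energy at first order by at most
      minus the relative entropy of [rho] with respect to [g].  Hence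
      [rho = g] almost everywhere ([euler_lagrange]), so that [rho] has a
      continuous, positive, 1-periodic version [f], which is again a minimiser.

    - A reflection [x |-> s - x] of the circle has two antipodal fixed points,
      which bound two open arcs exchanged by the reflection.  The polarization
      of [f] takes at [x] the larger of [f x] and [f (s - x)] on one of the
      arcs, and the smaller one on the other.  The entropy does not change, and
      the interaction energy does not increase, because two points of the same
      arc are closer to each other than one of them is to the mirror image of
      the other.  Hence the polarization is a minimiser
      ([polarized_minimiser]) and satisfies the Euler-Lagrange equation too.

    - Let [u x = f x - f (s - x)] and let [v] be the analogous difference for
      the polarization, so that [v] is [|u|] up to a sign that depends on the
      arc only.  If [u] vanishes at a point [q] of an open arc, the difference
      of the Euler-Lagrange equations of the polarization at [q] and at [s - q]
      says that [pot W v q = 0].  But [2 * pot W v q] is the integral of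
      [(W (q - y) - W (s - q - y)) * v y], which has a constant sign; so this
      product vanishes for every [y].  Since [W 0 < W x] off the integers, its
      first factor does not vanish near [y = q], and [u] vanishes in a
      neighbourhood of [q] ([polarization_rigidity]).  By connectedness, on
      each arc [u] vanishes everywhere or nowhere ([arc_dichotomy]).

    - Let [f] be maximal at [m], and let [x] be closer to [m] than [y].  The
      reflection that exchanges [x] and [y] leaves [x] and [m] on the same arc.
      If [f x < f y], then [f m < f (s - m)] by the previous step, which
      contradicts the choice of [m].  So [f] is a non-increasing function of the
      distance to [m] ([decreasing]), and [f (. + m)] is the rearrangement of
      [rho]. *)

(** * Geodesic distance and arcs on the circle *)

Section Geometry.
Context {R : realType}.
Implicit Types (x y a b : R) (n : int).

Definition periodic (f : R -> R) := forall x n, f (x + n%:~R) = f x.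

Definition tdist (x : R) : R := Num.min (frac x) (1 - frac x).

Lemma frac_ge0 x : 0 <= frac x.
Proof. by rewrite /frac subr_ge0 floor_le_tmp. Qed.

Lemma frac_lt1 x : frac x < 1.
Proof. by rewrite /frac ltrBlDl; have := floorD1_gt x; rewrite intrD. Qed.

Lemma fracK x : frac x + (Num.floor x)%:~R = x.
Proof. by rewrite /frac subrK. Qed.

Lemma frac_uniq x n : 0 <= x -> x < 1 -> frac (x + n%:~R) = x.
Proof.
move=> x0 x1; rewrite /frac (@floor_def _ _ n) ?addrK//.
by rewrite intrD; lra.
Qed.

Lemma frac_id x : 0 <= x -> x < 1 -> frac x = x.
Proof. by move=> x0 x1; rewrite -[x in frac x](addr0) (frac_uniq 0). Qed.

Lemma frac_periodic : periodic (@frac R).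
Proof.
move=> x n; rewrite -{1}(fracK x) -addrA -intrD.
by rewrite frac_uniq ?frac_ge0 ?frac_lt1.
Qed.

Lemma periodicB f : periodic f -> forall x n, f (x - n%:~R) = f x.
Proof. by move=> pf x n; rewrite -mulrNz pf. Qed.

Lemma periodic_frac f x : periodic f -> f (frac x) = f x.
Proof. by move=> pf; rewrite -{2}(fracK x) pf. Qed.

Lemma tdist_periodic : periodic tdist.
Proof. by move=> x n; rewrite /tdist frac_periodic. Qed.

Lemma tdist_ge0 x : 0 <= tdist x.
Proof. by have := frac_ge0 x; have := frac_lt1 x; rewrite /tdist le_min; lra. Qed.

Lemma tdist01 x : 0 <= x -> x <= 1 -> tdist x = Num.min x (1 - x).
Proof.
move=> x0; rewrite le_eqVlt => /orP[/eqP->|x1]; last by rewrite /tdist frac_id.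
have := tdist_periodic 0 1; rewrite add0r mulr1z => ->.
by rewrite /tdist frac_id// subr0 subrr minC.
Qed.

Lemma tdist_le_frac x : tdist x <= frac x.
Proof. by rewrite /tdist ge_min lexx. Qed.

Lemma tdist_le_compl x : tdist x <= 1 - frac x.
Proof. by rewrite /tdist ge_min lexx orbT. Qed.

Lemma tdist_le x n : tdist x <= `|x - n%:~R|.
Proof.
rewrite -(periodicB tdist_periodic x n); move: (x - _) => {x n} x.
have f0 := frac_ge0 x; have f1 := frac_lt1 x; have xE := fracK x.
have [k0|k0] := leP 0 (Num.floor x).
  have : 0 <= (Num.floor x)%:~R :> R by rewrite ler0z.
  by move=> k0'; have := tdist_le_frac x; have := ler_norm x; lra.
have : (Num.floor x)%:~R <= -1 :> R.
  by rewrite -(intrN R 1) ler_int; move: k0; case: (Num.floor x) => // -[].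
by have := tdist_le_compl x; have := ler_norm (- x); rewrite normrN; lra.
Qed.

(** Rounding [x + 1/2] down selects the nearest integer, which is how the
    potential brings its argument into the fundamental domain around 0. *)
Lemma tdist_round x : tdist x = `|x - (Num.floor (x + 2^-1))%:~R|.
Proof.
apply/eqP; rewrite eq_le tdist_le /=.
set k := Num.floor _.
have := floor_le_tmp (x + 2^-1); have := floorD1_gt (x + 2^-1).
rewrite -/k intrD => k1 k2.
rewrite -(periodicB tdist_periodic x k).
have [y0 y1] : - 2^-1 <= x - k%:~R /\ x - k%:~R < 2^-1 by split; lra.
move: (x - k%:~R) y0 y1 => y y0 y1.
have [y_ge0|y_lt0] := leP 0 y.
  by rewrite tdist01 ?ger0_norm// ?le_min; lra.
by rewrite -(tdist_periodic y 1) mulr1z tdist01 ?ltr0_norm// ?le_min; lra.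
Qed.

Lemma tdist_attained x : exists n, tdist x = `|x - n%:~R|.
Proof. by exists (Num.floor (x + 2^-1)); exact: tdist_round. Qed.

Lemma tdistN x : tdist (- x) = tdist x.
Proof.
suff le y : tdist (- y) <= tdist y.
  by apply/eqP; rewrite eq_le le -{1}(opprK x) le.
have [n ->] := tdist_attained y.
by rewrite -normrN opprB addrC -[n in n%:~R]opprK mulrNz tdist_le.
Qed.

Lemma tdist_lipschitz x y : `|tdist x - tdist y| <= `|x - y|.
Proof.
suff le a b : tdist a <= tdist b + `|a - b|.
  by rewrite ler_norml; have := le x y; have := le y x; rewrite (distrC y); lra.
have [n ->] := tdist_attained b; apply: le_trans (tdist_le a n) _.
by rewrite [leRHS]addrC (_ : a - n%:~R = (a - b) + (b - n%:~R)) ?ler_normD//; ring.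
Qed.

Lemma tdist_eq0 x : tdist x = 0 -> exists n, x = n%:~R.
Proof.
have [n ->] := tdist_attained x => /eqP; rewrite normr_eq0 subr_eq0 => /eqP.
by exists n.
Qed.

(** The fixed points of [x |-> - x] on the circle are 0 and 1/2; the sign tells
    which of the two arcs between them contains [x].  It is never 0: the fixed
    points are attributed to the arc that follows them. *)
Definition arc_sign (x : R) : R := if frac x < 2^-1 then 1 else -1.

Lemma arc_sign_periodic : periodic arc_sign.
Proof. by move=> x n; rewrite /arc_sign frac_periodic. Qed.

Lemma normr_arc_sign x : `|arc_sign x| = 1.
Proof. by rewrite /arc_sign; case: ifP; rewrite ?normrN normr1. Qed.

Lemma tdist_sub_add_frac a b :
  (arc_sign a * arc_sign b) * (tdist (a + b) - tdist (a - b)) =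
  (arc_sign (frac a) * arc_sign (frac b)) *
    (tdist (frac a + frac b) - tdist (frac a - frac b)).
Proof.
rewrite !(periodic_frac _ arc_sign_periodic); congr (_ * (_ - _)).
  rewrite -[RHS](tdist_periodic _ (Num.floor a + Num.floor b)).
  by rewrite intrD addrACA !fracK.
rewrite -[RHS](tdist_periodic _ (Num.floor a - Num.floor b)).
by rewrite intrB addrACA -opprD !fracK.
Qed.

(** The geometric fact behind polarization: two points on the same arc are at
    most as far apart as one of them is from the mirror image of the other, and
    the opposite holds for points on different arcs. *)
Lemma tdist_sub_add a b :
  0 <= (arc_sign a * arc_sign b) * (tdist (a + b) - tdist (a - b)).
Proof.
rewrite tdist_sub_add_frac.
have := frac_ge0 a; have := frac_lt1 a; move: (frac a) => {a} a a1 a0.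
have := frac_ge0 b; have := frac_lt1 b; move: (frac b) => {b} b b1 b0.
wlog ab : a b a1 a0 b1 b0 / b <= a.
  move=> H; have [/H|/ltW/H] := leP b a; first exact.
  rewrite -(tdistN (b - a)) opprB (addrC b) (mulrC (arc_sign b)); exact.
have dE : tdist (a - b) = Num.min (a - b) (1 - (a - b)) by rewrite tdist01; lra.
rewrite {1 2}/arc_sign !frac_id//; have [ha|ha] := ltP a 2^-1.
  have hb : b < 2^-1 by lra.
  rewrite hb !mul1r subr_ge0 (tdist01 (x := a + b)) ?dE; [|lra..].
  by rewrite ge_min le_min; lra.
have [hb|hb] := ltP b 2^-1.
  rewrite mulr1 mulN1r oppr_ge0 subr_le0 dE le_min.
  have := tdist_le (a + b) 1; rewrite mulr1z.
  have [k|k] := leP 0 (a + b - 1); first rewrite ger0_norm//; first lra.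
  by rewrite ltr0_norm//; lra.
rewrite mulrNN !mul1r subr_ge0 dE -(periodicB tdist_periodic _ 1) mulr1z.
by rewrite tdist01 ?ge_min ?le_min; lra.
Qed.

End Geometry.

(** * Invariance of Lebesgue measure under reflections and periods *)

Section Invariance.
Context {R : realType}.
Local Notation mu := (@lebesgue_measure R).
Local Notation TR := (measurableTypeR R).

Let reflection (s : R) (x : TR) : TR := s - x.

Lemma measurable_reflection (s : R) : measurable_fun [set: TR] (reflection s).
Proof.
apply: (@continuous_measurable_fun R) => x.
by apply: cvgB; [exact: cvg_cst|exact: cvg_id].
Qed.

Lemma lebesgue_measure_reflection (s : R) (A : set TR) : measurable A ->
  mu (reflection s @^-1` A) = mu A.
Proof.
move=> mA.
rewrite [RHS](lebesgue_measure_unique (mu := pushforward mu (reflection s)))//.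
  exact: measurable_reflection.
move=> mr X [[a b] _ <-].
transitivity (mu `[s - b, s - a[%classic); last first.
  congr (mu _); rewrite /reflection.
  by apply/seteqP; split => x /=; rewrite !in_itv/=; lra.
rewrite !lebesgue_measure_itv/= !lte_fin ltrD2l ltrN2.
by case: ifP => // _; rewrite -!EFinB; congr EFin; ring.
Qed.

Lemma integral_reflection (s : R) (A : set TR) (f : TR -> \bar R) :
  measurable A -> measurable_fun A f -> (forall x, 0 <= f x)%E ->
  (\int[mu]_(x in A) f x = \int[mu]_(x in reflection s @^-1` A) f (s - x)%R)%E.
Proof.
move=> mA mf f0.
rewrite -(ge0_integral_pushforward (measurable_reflection s) mu mA mf)//.
apply: eq_measure_integral; first exact: measurable_reflection.
by move=> mr B mB _; apply/esym; exact: lebesgue_measure_reflection.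
Qed.

(** A translation is the composition of two reflections. *)
Lemma integral_translation (s : R) (A : set TR) (f : TR -> \bar R) :
  measurable A -> measurable_fun setT f -> (forall x, 0 <= f x)%E ->
  (\int[mu]_(x in A) f x =
   \int[mu]_(x in (fun x : TR => (x + s)%R : TR) @^-1` A) f (x + s)%R)%E.
Proof.
move=> mA mf f0; rewrite (integral_reflection s)//; last exact: measurable_funTS.
rewrite (integral_reflection 0)//; last 2 first.
- by rewrite -[X in measurable X]setTI; exact: measurable_reflection.
- apply: measurable_funTS; apply: (measurableT_comp mf); exact: measurable_reflection.
rewrite (_ : _ @^-1` (_ @^-1` _) = (fun x : TR => (x + s)%R : TR) @^-1` A).
  by apply: eq_integral => x _; rewrite sub0r opprK addrC.
by apply/seteqP; split => x; rewrite /reflection /= sub0r opprK addrC.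
Qed.

(** An integer [k] in the period splits it into two pieces, which integer
    translations reassemble into a period that starts at [k]. *)
Lemma integral_period (a : R) (f : TR -> \bar R) :
  measurable_fun setT f -> (forall x, 0 <= f x)%E ->
  (forall x (n : int), f (x + n%:~R)%R = f x) ->
  (\int[mu]_(x in `[a, (a + 1)%R]) f x = \int[mu]_(x in `[0%R, 1%R]) f x)%E.
Proof.
move=> mf f0 pf.
have oc b c : (\int[mu]_(x in `[b, c]) f x = \int[mu]_(x in `[b, c[) f x)%E.
  by rewrite integral_itv_bndo_bndc//; exact: measurable_funTS.
have split3 b c d : b <= c -> c <= d ->
    (\int[mu]_(x in `[b, d[) f x =
     \int[mu]_(x in `[b, c[) f x + \int[mu]_(x in `[c, d[) f x)%E.
  move=> bc cd; rewrite -integral_setU//.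
  - by congr (integral mu _ f); apply/seteqP; split => x /=; rewrite !in_itv/=; lra.
  - exact: measurable_funTS.
  - apply/disj_setPRL => x /=; rewrite !in_itv/=; lra.
have shift (n : int) b c :
    (\int[mu]_(x in `[(b + n%:~R)%R, (c + n%:~R)%R[) f x =
     \int[mu]_(x in `[b, c[) f x)%E.
  rewrite (integral_translation n%:~R)//.
  rewrite (_ : _ @^-1` _ = `[b, c[%classic).
    by apply: eq_integral => x _; rewrite pf.
  by apply/seteqP; split => x /=; rewrite !in_itv/= lerD2r ltrD2r.
rewrite !oc; set k := Num.floor a + 1.
have ak : a < k%:~R by exact: floorD1_gt.
have ka : k%:~R <= a + 1 by rewrite intrD lerD2r floor_le_tmp.
rewrite (split3 a k%:~R)//; last exact: ltW.
have := shift k 0 1; rewrite add0r (addrC 1) => <-.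
rewrite (split3 k%:~R (a + 1) (k%:~R + 1)) ?lerD2r ?(ltW ak)//.
by have := shift 1 a k%:~R; rewrite mulr1z => ->; rewrite addeC.
Qed.

End Invariance.

(** * Integration over one period *)

Section UnitIntegral.
Context {R : realType}.
Local Notation mu := (@lebesgue_measure R).
Local Notation D := (`[0%R, 1%R]%classic : set R).
Implicit Types (f g h : R -> R).

Definition L1 (h : R -> R) : Prop := mu.-integrable D (EFin \o h).
(** The circle is represented by the closed unit interval: its endpoint 1 is
    negligible. *)
Definition tint (h : R -> R) : R := (\int[mu]_(x in D) h x)%R.

Lemma measurable_period : measurable (D : set (measurableTypeR R)).
Proof. exact: measurable_itv. Qed.
Hint Resolve measurable_period : core.

Lemma period_mass : mu D = 1%E.
Proof. by rewrite lebesgue_measure_itv/= lte_fin ltr01 oppr0 adde0. Qed.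

Lemma L1D f g : L1 f -> L1 g -> L1 (fun x => f x + g x).
Proof. by move=> lf lg; apply: (integrableD _ lf lg). Qed.

Lemma L1B f g : L1 f -> L1 g -> L1 (fun x => f x - g x).
Proof. by move=> lf lg; apply: (integrableB _ lf lg). Qed.

Lemma L1Z (k : R) f : L1 f -> L1 (fun x => k * f x).
Proof. by move=> lf; apply: (integrableZl _ k lf). Qed.

Lemma L1N f : L1 f -> L1 (fun x => - f x).
Proof. by move=> lf; exact: (integrableN lf). Qed.

Lemma L1_cst (k : R) : L1 (fun=> k).
Proof. apply: measurable_bounded_integrable => //=; first by rewrite period_mass ltry.
by exists `|k|; split => // m km x _ /=; exact: ltW. Qed.

Lemma L1_norm f : L1 f -> L1 (fun x => `|f x|).
Proof. by move=> lf; apply: integrable_norm lf. Qed.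

Lemma L1_measurable f : L1 f -> measurable_fun D f.
Proof. by move=> lf; apply/measurable_EFinP; exact: measurable_int lf. Qed.

Lemma L1_le f g : measurable_fun D f -> (forall x, D x -> `|f x| <= g x) ->
  L1 g -> L1 f.
Proof.
move=> mf fg lg; apply: (le_integrable measurable_period _ _ lg) => /=.
  exact/measurable_EFinP.
by move=> x Dx; rewrite lee_fin (le_trans (fg _ Dx))// ler_norm.
Qed.

Lemma L1_bounded (M : R) f : measurable_fun setT f ->
  (forall x, `|f x| <= M) -> L1 f.
Proof.
move=> mf fM; apply: (@L1_le f (fun=> M)) => //; last exact: L1_cst.
exact: measurable_funTS.
Qed.

Lemma L1_mul_bounded (M : R) f g : measurable_fun setT f ->
  (forall x, `|f x| <= M) -> L1 g -> L1 (fun x => f x * g x).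
Proof.
move=> mf fM lg; apply: (@L1_le _ (fun x => M * `|g x|)).
- by apply: measurable_funM; [exact: measurable_funTS|exact: L1_measurable].
- by move=> x _; rewrite normrM ler_wpM2r.
- by apply: L1Z; exact: L1_norm.
Qed.

Lemma tintD f g : L1 f -> L1 g -> tint (fun x => f x + g x) = tint f + tint g.
Proof. by move=> lf lg; rewrite /tint RintegralD. Qed.

Lemma tintB f g : L1 f -> L1 g -> tint (fun x => f x - g x) = tint f - tint g.
Proof. by move=> lf lg; rewrite /tint RintegralB. Qed.

Lemma tintZ (k : R) f : L1 f -> tint (fun x => k * f x) = k * tint f.
Proof. by move=> lf; rewrite /tint RintegralZl. Qed.

Lemma tint_cst (k : R) : tint (fun=> k) = k.
Proof.
rewrite /tint Rintegral_cst// [X in fine X](_ : _ = 1%E) ?mulr1//.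
exact: period_mass.
Qed.

Lemma eq_tint f g : (forall x, f x = g x) -> tint f = tint g.
Proof.
by move=> fg; rewrite /tint; congr fine; apply: eq_integral => x _; rewrite fg.
Qed.

Lemma le_tint f g : L1 f -> L1 g -> (forall x, D x -> f x <= g x) ->
  tint f <= tint g.
Proof. by move=> lf lg fg; apply: le_Rintegral. Qed.

Lemma tint_ge0 f : (forall x, D x -> 0 <= f x) -> 0 <= tint f.
Proof. by move=> f0; apply: Rintegral_ge0. Qed.

Lemma le_norm_tint f : L1 f -> `|tint f| <= tint (fun x => `|f x|).
Proof. by move=> lf; apply: le_normr_Rintegral. Qed.

Lemma EFin_tint f : L1 f -> (tint f)%:E = (\int[mu]_(x in D) (f x)%:E)%E.
Proof. by move=> lf; rewrite /tint fineK//; exact: integrable_fin_num. Qed.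

Definition ae_eq_torus f g := {ae mu, forall x, D x -> f x = g x}.

Lemma aeS (P Q : R -> Prop) : (forall x, P x -> Q x) ->
  {ae mu, forall x, P x} -> {ae mu, forall x, Q x}.
Proof. by move=> PQ; apply: (@filterS _ _ (ae_filter_ringOfSetsType mu)). Qed.

Lemma ae_eq_tint f g : measurable_fun D f -> measurable_fun D g ->
  ae_eq_torus f g -> tint f = tint g.
Proof.
move=> mf mg fg; rewrite /tint /Rintegral; congr fine.
apply: ae_eq_integral => //.
- exact/measurable_EFinP.
- exact/measurable_EFinP.
- by apply: aeS fg => x /= fg' /fg' ->.
Qed.

Lemma ae_eq_L1 f g : measurable_fun D f -> measurable_fun D g ->
  ae_eq_torus f g -> L1 f -> L1 g.
Proof.
move=> mf mg fg /integrableP[_ lf]; apply/integrableP; split.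
  exact/measurable_EFinP.
rewrite (_ : integral _ _ _ = \int[mu]_(x in D) `|(EFin \o f) x|)%E//.
apply: ae_eq_integral => //.
- by apply: measurableT_comp => //; exact/measurable_EFinP.
- by apply: measurableT_comp => //; exact/measurable_EFinP.
- by apply: aeS fg => x /= fg' /fg' ->.
Qed.

Lemma tint_eq0_ae f : L1 f -> (forall x, D x -> 0 <= f x) -> tint f <= 0 ->
  ae_eq_torus f (fun=> 0).
Proof.
move=> lf f0 If; have mf := L1_measurable lf.
have /ae_eq_integral_abs : (\int[mu]_(x in D) `|(f x)%:E| = 0)%E.
  under eq_integral => x /set_mem Dx do rewrite gee0_abs ?lee_fin ?f0//.
  by rewrite -EFin_tint//; congr EFin; apply/eqP; rewrite eq_le If tint_ge0.
move=> /(_ measurable_period) H.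
have /H : measurable_fun D (EFin \o f) by exact/measurable_EFinP.
by apply: aeS => x /[apply] -[].
Qed.

(** The length of a nonempty interval to the right of [x] is positive, so that a
    null set cannot contain it. *)
Lemma ae_eq_torus_dense f g (x e : R) : ae_eq_torus f g -> 0 <= x < 1 -> 0 < e ->
  exists z, [/\ D z, `|z - x| < e & f z = g z].
Proof.
move=> [N [mN N0 fgN]] x01 e0.
pose b := Num.min (x + e) 1.
have xb : x < b by rewrite lt_min; lra.
apply: contrapT => nex.
have sub : `]x, b[%classic `<=` N.
  move=> z /=; rewrite in_itv/= => /andP[xz]; rewrite lt_min => /andP[ze z1].
  apply: fgN => /= fgz; apply: nex; exists z; split.
  - by rewrite /= in_itv/=; lra.
  - by rewrite gtr0_norm; lra.
  - by apply: fgz; rewrite in_itv/=; lra.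
have : (mu `]x, b[%classic <= mu N)%E.
  by apply: le_measure => //; rewrite inE//; exact: measurable_itv.
rewrite [X in (_ <= X)%E](_ : _ = 0%E)// lebesgue_measure_itv/= lte_fin xb.
by rewrite -EFinB lee_fin; lra.
Qed.

(** Almost everywhere equality improves to equality at the points of continuity;
    periodicity is what reaches the points outside the fundamental domain. *)
Lemma ae_eq_torus_periodic_eq f g (x : R) :
  ae_eq_torus f g -> periodic f -> periodic g ->
  {for x, continuous f} -> {for x, continuous g} -> f x = g x.
Proof.
move=> fg pf pg cf cg; apply/eqP; rewrite -subr_eq0 -normr_le0.
apply/ler_addgt0Pl => e e0; rewrite addr0.
have e20 : 0 < e / 2 by rewrite divr_gt0.
have /cvgrPdist_lt/(_ _ e20)/nbhs_ballP[d1 /= d10 H1] := cf.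
have /cvgrPdist_lt/(_ _ e20)/nbhs_ballP[d2 /= d20 H2] := cg.
have d0 : 0 < Num.min d1 d2 by rewrite lt_min d10.
have x01 : 0 <= frac x < 1 by rewrite frac_ge0 frac_lt1.
have [z [_ zx fgz]] := ae_eq_torus_dense fg x01 d0.
pose y := z + (Num.floor x)%:~R.
have yx : `|x - y| < Num.min d1 d2.
  rewrite distrC /y; rewrite -[X in `|_ - X|](fracK x).
  by rewrite opprD addrACA subrr addr0.
move: yx; rewrite lt_min => /andP[/H1 k1 /H2 k2].
have fgy : f y = g y by rewrite /y pf pg.
rewrite (_ : f x - g x = (f x - f y) - (g x - g y)); last by rewrite fgy; ring.
by rewrite (le_trans (ler_normB _ _))//; lra.
Qed.

(** Adding the bound [M] to [f] reduces to nonnegative functions. *)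
Lemma tint_reflection (M s : R) f : measurable_fun setT f ->
  (forall x, `|f x| <= M) -> periodic f ->
  tint (fun x => f (s - x)) = tint f.
Proof.
move=> mf fM pf.
have mfs : measurable_fun setT (fun x : R => f (s - x)).
  by apply: (measurableT_comp mf); exact: measurable_reflection.
suff: tint (fun x => f (s - x) + M) = tint (fun x => f x + M).
  rewrite !tintD ?tint_cst; [by move/addIr|..]; try exact: L1_cst.
  - exact: L1_bounded fM.
  - by apply: (@L1_bounded M).
have mg : measurable_fun [set: measurableTypeR R] (fun x => (f x + M)%:E).
  by apply/measurable_EFinP; apply: measurable_funD.
have g0 x : (0 <= (f x + M)%:E)%E.
  by rewrite lee_fin; have := fM x; rewrite ler_norml; lra.
have pg x (n : int) : ((f (x + n%:~R) + M)%:E = (f x + M)%:E)%E by rewrite pf.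
rewrite /tint /Rintegral; congr fine.
rewrite -(integral_period (s - 1) mg g0 pg) subrK.
rewrite (integral_reflection s)//; [|exact: measurable_funTS].
congr (integral mu _ _); apply/seteqP; split => x /=; rewrite !in_itv/=; lra.
Qed.

End UnitIntegral.
#[export] Hint Resolve measurable_period : core.

(** * Convolution with the potential *)

Section Potential.
Context {R : realType}.
Local Notation mu := (@lebesgue_measure R).
Local Notation TR := (measurableTypeR R).
Local Notation D := (`[0%R, 1%R]%classic : set R).

Implicit Types (f g h : R -> R).

(** All that the argument uses of the potential: an even, periodic, Lipschitz
    function that does not decrease with the distance to 0 and whose only
    minimum point on the circle is 0. *)
Record torus_kernel (W : R -> R) (M K : R) : Prop := TorusKernel {
  kernel_even : forall x, W (- x) = W x;
  kernel_periodic : periodic W;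
  kernel_bounded : forall x, `|W x| <= M;
  kernel_lipschitz : forall x y, `|W x - W y| <= K * `|x - y|;
  kernel_mono : forall x y, tdist x <= tdist y -> W x <= W y;
  kernel_strict : forall x, 0 < tdist x -> W 0 < W x }.

Variables (W : R -> R) (M K : R).
Hypothesis kW : torus_kernel W M K.

Definition pot (h : R -> R) (x : R) : R := tint (fun y => W (x - y) * h y).

Lemma lipschitz_continuous (f : R -> R) (k : R) :
  (forall x y, `|f x - f y| <= k * `|x - y|) -> continuous f.
Proof.
move=> fk x; apply/cvgrPdist_le => e e0.
have k0 : 0 <= k.
  by have := fk 1 0; rewrite subr0 normr1 mulr1; apply: le_trans.
have d0 : 0 < e / (k + 1) by rewrite divr_gt0//; lra.
near=> y; apply: le_trans (fk x y) _.
have xy : `|x - y| <= e / (k + 1).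
  by near: y; apply/nbhs_ballP; exists (e / (k + 1)) => // z /ltW.
rewrite (le_trans (y := k * (e / (k + 1))))//; first exact: ler_wpM2l.
by rewrite mulrCA ler_piMr ?(ltW e0)// ler_pdivrMr; lra.
Unshelve. all: by end_near. Qed.

Lemma continuous_kernel : continuous W.
Proof. exact: lipschitz_continuous (kernel_lipschitz kW). Qed.

Lemma measurable_kernel : measurable_fun setT W.
Proof. by apply: continuous_measurable_fun; exact: continuous_kernel. Qed.

Lemma measurable_kernel_sub x : measurable_fun setT (fun y : R => W (x - y)).
Proof.
by apply: (measurableT_comp measurable_kernel); exact: measurable_reflection.
Qed.

Lemma L1_pot h x : L1 h -> L1 (fun y => W (x - y) * h y).
Proof.
apply: L1_mul_bounded; first exact: measurable_kernel_sub.
by move=> y; exact: kernel_bounded kW _.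
Qed.

Lemma pot_bounded h x : L1 h -> `|pot h x| <= M * tint (fun y => `|h y|).
Proof.
move=> lh; rewrite (le_trans (le_norm_tint (L1_pot x lh)))//.
rewrite -tintZ; last exact: L1_norm.
apply: le_tint; [by apply: L1_norm; exact: L1_pot|by apply: L1Z; exact: L1_norm|].
by move=> y _; rewrite normrM ler_wpM2r//; exact: kernel_bounded kW _.
Qed.

(** The convolution inherits the Lipschitz constant of the potential; this makes
    it continuous for every integrable density. *)
Lemma pot_lipschitz h x y : L1 h ->
  `|pot h x - pot h y| <= K * tint (fun y => `|h y|) * `|x - y|.
Proof.
move=> lh; rewrite -tintB; [|exact: L1_pot..].
rewrite (le_trans (le_norm_tint _))//; first by apply: L1B; exact: L1_pot.
rewrite mulrAC -tintZ; last exact: L1_norm.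
apply: le_tint.
- by apply: L1_norm; apply: L1B; exact: L1_pot.
- by apply: L1Z; exact: L1_norm.
move=> z _; rewrite -mulrBl normrM ler_wpM2r//.
have := kernel_lipschitz kW (x - z) (y - z).
by rewrite opprB addrA subrK.
Qed.

Lemma continuous_pot h : L1 h -> continuous (pot h).
Proof. by move=> lh; apply: lipschitz_continuous => x y; exact: pot_lipschitz. Qed.

Lemma measurable_pot h : L1 h -> measurable_fun setT (pot h).
Proof. by move=> lh; apply: continuous_measurable_fun; exact: continuous_pot. Qed.

Lemma pot_periodic h : periodic (pot h).
Proof.
move=> x n; apply: eq_tint => y.
by rewrite addrAC (kernel_periodic kW).
Qed.

Lemma potD f g x : L1 f -> L1 g -> pot (fun y => f y + g y) x = pot f x + pot g x.
Proof.
move=> lf lg; rewrite -tintD; [|exact: L1_pot..].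
by apply: eq_tint => y; rewrite mulrDr.
Qed.

Lemma potZ k f x : L1 f -> pot (fun y => k * f y) x = k * pot f x.
Proof.
move=> lf; rewrite -tintZ; [|exact: L1_pot].
by apply: eq_tint => y; rewrite mulrCA.
Qed.

Lemma L1_mul_pot f g : L1 f -> L1 g -> L1 (fun x => f x * pot g x).
Proof.
move=> lf lg; rewrite (_ : (fun x => _) = fun x => pot g x * f x); last first.
  by apply/funext => x; rewrite mulrC.
by apply: (L1_mul_bounded (M := M * tint (fun y => `|g y|))) => // [|x];
  [exact: measurable_pot|exact: pot_bounded].
Qed.

Lemma ae_eq_pot f g : L1 f -> L1 g -> ae_eq_torus f g -> pot f = pot g.
Proof.
move=> lf lg fg; apply/funext => x; apply: ae_eq_tint.
- by apply: L1_measurable; exact: L1_pot.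
- by apply: L1_measurable; exact: L1_pot.
- by apply: aeS fg => y /= fg /fg ->.
Qed.

(** Since the potential is even, convolution commutes with the reflections of the
    circle. *)
Lemma pot_reflection (B s : R) (h : R -> R) x : measurable_fun setT h ->
  (forall y, `|h y| <= B) -> periodic h ->
  pot (fun y => h (s - y)) x = pot h (s - x).
Proof.
move=> mh hB ph.
rewrite /pot -(tint_reflection (M := M * B) s (f := fun y => W (s - x - y) * h y)).
- apply: eq_tint => y; congr (_ * _).
  by rewrite -(kernel_even kW); congr W; ring.
- by apply: measurable_funM => //; exact: measurable_kernel_sub.
- by move=> y; rewrite normrM ler_pM//; exact: kernel_bounded kW _.
- move=> y n; rewrite ph; congr (_ * _).
  by rewrite opprD addrA (periodicB (kernel_periodic kW)).
Qed.

Let zext (h : R -> R) (x : R) : R := if x \in D then h x else 0.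

Lemma measurable_zext f : measurable_fun D f ->
  measurable_fun [set: TR] (zext f).
Proof. exact: (proj1 (measurable_restrictT f measurable_period)). Qed.

Lemma integral_restrict (f : R -> R) g : L1 f ->
  (forall y, g y = zext f y) -> (\int[mu]_y (g y)%:E = (tint f)%:E)%E.
Proof.
move=> lf gE; rewrite EFin_tint// [RHS]integral_mkcond; apply: eq_integral => y _.
by rewrite gE patchE /zext; case: ifP.
Qed.

Let pair f g (z : TR * TR) : \bar R :=
  (W (z.1 - z.2) * zext f z.1 * zext g z.2)%:E.

Lemma measurable_pair f g : L1 f -> L1 g ->
  measurable_fun [set: TR * TR] (pair f g).
Proof.
move=> lf lg; apply/measurable_EFinP; apply: measurable_funM.
  apply: measurable_funM.
    apply: (measurableT_comp measurable_kernel); apply: measurable_funB;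
      [exact: measurable_fst|exact: measurable_snd].
  apply: measurableT_comp; last exact: measurable_fst.
  by apply: measurable_zext; exact: L1_measurable.
apply: measurableT_comp; last exact: measurable_snd.
by apply: measurable_zext; exact: L1_measurable.
Qed.

Lemma pair_integral f g x : L1 g ->
  (\int[mu]_y pair f g (x, y) = (zext f x * pot g x)%:E)%E.
Proof.
move=> lg; rewrite -tintZ; last exact: L1_pot.
apply: integral_restrict; first by apply: L1Z; exact: L1_pot.
by move=> y /=; rewrite /zext; case: (y \in _); rewrite ?mulr0//; ring.
Qed.

Lemma integrable_pair f g : L1 f -> L1 g ->
  (mu \x mu)%E.-integrable setT (pair f g).
Proof.
move=> lf lg; apply/integrable12ltyP; first exact: measurable_pair.
pose C := M * tint (fun y => `|g y|).
apply: (@le_lt_trans _ _ (\int[mu]_x (C * `|zext f x|)%:E)%E).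
  apply: ge0_le_integral => //.
  - by move=> x _; apply: integral_ge0.
  - apply: (measurable_fun_fubini_tonelli_F (abse \o pair f g)) => //=.
    by apply: measurableT_comp => //; exact: measurable_pair.
  - apply/measurable_EFinP; apply: measurable_funM => //.
    apply: measurableT_comp => //.
    by apply: measurable_zext; exact: L1_measurable.
  move=> x _.
  have lh : L1 (fun y => `|zext f x| * `|W (x - y) * g y|).
    by apply: L1Z; apply: L1_norm; exact: L1_pot.
  rewrite (integral_restrict lh); last first.
    move=> y /=; rewrite /pair /= {2 3}/zext; case: (y \in _).
      by rewrite !normrM mulrCA mulrA.
    by rewrite mulr0 normr0.
  rewrite lee_fin tintZ; last by apply: L1_norm; exact: L1_pot.
  rewrite mulrC ler_wpM2r// /C -tintZ; last exact: L1_norm.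
  apply: le_tint; [by apply: L1_norm; exact: L1_pot| |].
    by apply: L1Z; exact: L1_norm.
  by move=> y _; rewrite normrM ler_wpM2r//; exact: kernel_bounded kW _.
rewrite (@integral_restrict (fun x => C * `|f x|)); first exact: ltry.
  by apply: L1Z; exact: L1_norm.
by move=> y; rewrite /zext; case: (y \in _); rewrite // normr0 mulr0.
Qed.

(** Fubini's theorem, applied to the extensions by zero, turns the interaction
    energy into a single integral. *)
Lemma integral_square f g : L1 f -> L1 g ->
  (\int[mu \x mu]_(z in D `*` D) (W (z.1 - z.2) * f z.1 * g z.2)%:E =
   (tint (fun x => f x * pot g x))%:E)%E.
Proof.
move=> lf lg; rewrite integral_mkcond.
transitivity (\int[mu \x mu]_z pair f g z)%E.
  apply: eq_integral => -[x y] _; rewrite /pair patchE /zext /= in_setX /=.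
  by case: (x \in _); case: (y \in _); rewrite /= ?mulr0 ?mul0r.
rewrite -integral12_prod_meas1; last exact: integrable_pair.
under eq_integral do rewrite /fubini_F pair_integral//.
apply: integral_restrict; first exact: L1_mul_pot.
by move=> y; rewrite /zext; case: (y \in _); rewrite ?mul0r.
Qed.

(** Fubini's theorem again, in the two orders, with the potential even. *)
Lemma pot_symmetric f g : L1 f -> L1 g ->
  tint (fun x => f x * pot g x) = tint (fun x => g x * pot f x).
Proof.
move=> lf lg; apply: EFin_inj.
transitivity (\int[mu \x mu]_z pair f g z)%E.
  rewrite -integral12_prod_meas1; last exact: integrable_pair.
  under eq_integral do rewrite /fubini_F pair_integral//.
  apply/esym; apply: integral_restrict; first exact: L1_mul_pot.
  by move=> y; rewrite /zext; case: (y \in _); rewrite ?mul0r.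
rewrite -integral21_prod_meas1; last exact: integrable_pair.
transitivity (\int[mu]_y (zext g y * pot f y)%:E)%E.
  apply: eq_integral => y _; rewrite -pair_integral//.
  apply: eq_integral => x _; congr EFin => /=.
  by rewrite -(kernel_even kW) opprB; ring.
apply: integral_restrict; first exact: L1_mul_pot.
by move=> y; rewrite /zext; case: (y \in _); rewrite ?mul0r.
Qed.

End Potential.

(** * Energy of a density *)

Section Energy.
Context {R : realType}.
Local Notation mu := (@lebesgue_measure R).
Local Notation TR := (measurableTypeR R).
Local Notation D := (`[0%R, 1%R]%classic : set R).
Implicit Types (f g h : R -> R).

Definition xlnx (x : R) : R := x * ln x.

(** The densities at which the free energy is finite. *)
Record admissible (h : R -> R) : Prop := Admissible {
  adm_measurable : measurable_fun setT h;
  adm_ge0 : forall x, 0 <= h x;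
  adm_L1 : L1 h;
  adm_mass : tint h = 1;
  adm_entropy : L1 (xlnx \o h) }.

Definition energy (W h : R -> R) : R :=
  tint (xlnx \o h) + 2^-1 * tint (fun x => h x * pot W h x).

Lemma measurable_xlnx : measurable_fun setT xlnx.
Proof. by apply: measurable_funM => //; exact: measurable_ln. Qed.

Lemma measurable_xlnx_comp h : measurable_fun setT h ->
  measurable_fun setT (xlnx \o h).
Proof. by move=> mh; apply: measurableT_comp => //; exact: measurable_xlnx. Qed.

Section DensityProbability.
Variables (h : R -> R).

(** The probability measure with density [h] on the circle; the proof of
    admissibility is an argument so that the measure structures can be attached
    to the function. *)
Definition density_prob (ah : admissible h) (A : set TR) : \bar R :=
  (\int[mu]_(x in A) ((h \_ D) x)%:E)%E.

Hypothesis ah : admissible h.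

Let mhD : measurable_fun [set: TR] (EFin \o (h \_ D)).
Proof.
apply/measurable_EFinP; apply: (proj1 (measurable_restrictT h measurable_period)).
by apply: L1_measurable; exact: adm_L1.
Qed.

Let hD0 x : (0 <= ((h \_ D) x)%:E)%E.
Proof. by rewrite patchE; case: ifP => _; rewrite lee_fin//; exact: adm_ge0. Qed.

Let density_prob0 : density_prob ah set0 = 0%E.
Proof. by rewrite /density_prob integral_set0. Qed.

Let density_prob_ge0 A : (0 <= density_prob ah A)%E.
Proof. exact: integral_ge0. Qed.

Let density_prob_additive : semi_sigma_additive (density_prob ah).
Proof.
move=> /= F mF tF mUF; rewrite /density_prob; apply: cvg_toP.
  apply: ereal_nondecreasing_is_cvgn => m n mn.
  by apply: lee_sum_nneg_natr => // k _ _; exact: integral_ge0.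
by rewrite ge0_integral_bigcup//=; exact: measurable_funTS.
Qed.

HB.instance Definition _ := isMeasure.Build _ _ _ (density_prob ah)
  density_prob0 density_prob_ge0 density_prob_additive.

Let density_prob_setI A : density_prob ah A = density_prob ah (A `&` D).
Proof.
rewrite /density_prob [RHS]integral_mkcondr; apply: eq_integral => x _.
by rewrite [RHS]patchE !patchE; case: ifP.
Qed.

Lemma density_probE A : A `<=` D -> density_prob ah A = (\int[mu]_(x in A) (h x)%:E)%E.
Proof.
by move=> AD; apply: eq_integral => x /set_mem/AD/mem_set xD; rewrite patchE xD.
Qed.

Let density_prob_setT : density_prob ah setT = 1%E.
Proof.
rewrite density_prob_setI setTI density_probE//.
by rewrite -EFin_tint ?adm_mass//; exact: adm_L1.
Qed.

HB.instance Definition _ := @Measure_isProbability.Build _ _ R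
  (density_prob ah) density_prob_setT.

Lemma torus_density_prob : torus_probability (density_prob ah).
Proof.
rewrite /torus_probability -[LHS]/(density_prob ah torus) density_probE; last first.
  by move=> x; rewrite /torus /= !in_itv/=; lra.
rewrite integral_itv_bndo_bndc; last first.
  apply/measurable_EFinP; apply: measurable_funTS; exact: adm_measurable ah.
by rewrite -EFin_tint ?adm_mass//; exact: adm_L1.
Qed.

Lemma density_prob_dominates : density_prob ah `<< mu.
Proof.
apply/null_content_dominatesP => A mA A0; rewrite /density_prob.
by rewrite null_set_integral//; exact: measurable_funTS.
Qed.

End DensityProbability.

Section Density.
Variable P : probability TR R.
Hypothesis Pmu : P `<< mu.

Lemma density_EFin x : (density P x)%:E = Radon_Nikodym_SigmaFinite.f P mu x.
Proof. by rewrite /density fineK//; exact: Radon_Nikodym_SigmaFinite.f_fin_num. Qed.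

Lemma density_ge0 x : 0 <= density P x.
Proof. by rewrite -lee_fin density_EFin; exact: Radon_Nikodym_SigmaFinite.f_ge0. Qed.

Lemma measurable_density : measurable_fun [set: TR] (density P).
Proof.
apply/measurable_EFinP; rewrite (_ : _ \o _ = Radon_Nikodym_SigmaFinite.f P mu).
  exact: measurable_int (Radon_Nikodym_SigmaFinite.f_integrable Pmu).
by apply/funext => x; rewrite /= density_EFin.
Qed.

Lemma L1_density : L1 (density P).
Proof.
rewrite /L1 (_ : _ \o _ = Radon_Nikodym_SigmaFinite.f P mu); last first.
  by apply/funext => x; rewrite /= density_EFin.
apply: (integrableS measurableT) => //.
exact: Radon_Nikodym_SigmaFinite.f_integrable.
Qed.

Lemma density_integral (A : set TR) : measurable A ->
  (\int[mu]_(x in A) (density P x)%:E = P A)%E.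
Proof.
move=> mA; rewrite (Radon_Nikodym_SigmaFinite.f_integral Pmu)//.
by apply: eq_integral => x _; rewrite density_EFin.
Qed.

Lemma tint_density : torus_probability P -> tint (density P) = 1.
Proof.
move=> tP; apply: EFin_inj; rewrite EFin_tint; last exact: L1_density.
rewrite density_integral//; apply/eqP; rewrite eq_le probability_le1//=.
rewrite -tP; apply: le_measure.
- by rewrite inE; exact: measurable_itv.
- by rewrite inE.
- by move=> x; rewrite /torus/= !in_itv/=; lra.
Qed.

End Density.

(** The Radon-Nikodym derivative is only determined up to a null set. *)
Lemma density_density_prob h (ah : admissible h) :
  ae_eq_torus (density (density_prob ah)) h.
Proof.
have dom := density_prob_dominates ah.
have H : ae_eq mu D (EFin \o density (density_prob ah)) (EFin \o h).
  apply: integral_ae_eq => //.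
  - exact: L1_density.
  - by apply/measurable_EFinP; apply: L1_measurable; exact: adm_L1.
  move=> E ED mE; rewrite density_integral//.
  by rewrite -[LHS]/(density_prob ah E) density_probE.
by apply: aeS H => x /[apply] -[].
Qed.

Variables (w : R -> R) (gamma l M K : R).
Let W := potential w gamma l.
Hypothesis kW : torus_kernel W M K.

Lemma ae_eq_energy f g : measurable_fun setT f -> measurable_fun setT g ->
  L1 f -> L1 g -> ae_eq_torus f g -> energy W f = energy W g.
Proof.
move=> mf mg lf lg fg; rewrite /energy (ae_eq_pot kW lf lg fg).
congr (_ + _ * _).
  apply: ae_eq_tint; [| |by apply: aeS fg => x /= fg' /fg' ->];
  by apply: measurable_funTS; exact: measurable_xlnx_comp.
apply: ae_eq_tint.
- by apply: L1_measurable; apply: (L1_mul_pot kW).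
- by apply: L1_measurable; apply: (L1_mul_pot kW).
- by apply: aeS fg => x /= fg' /fg' ->.
Qed.

Lemma free_energyE (P : probability TR R) : P `<< mu ->
  L1 (xlnx \o density P) ->
  free_energy w gamma l P = (energy W (density P))%:E.
Proof.
move=> Pmu lP; rewrite /free_energy asboolT//.
rewrite (integral_square kW (L1_density Pmu) (L1_density Pmu)).
by rewrite -(EFin_tint lP).
Qed.

Lemma admissible1 : admissible (fun=> 1).
Proof.
split => //; first exact: L1_cst.
  exact: tint_cst.
rewrite (_ : _ \o _ = fun=> 0); first exact: L1_cst.
by apply/funext => x; rewrite /= /xlnx ln1 mulr0.
Qed.

Lemma free_energy_density_prob h (ah : admissible h) :
  free_energy w gamma l (density_prob ah) = (energy W h)%:E.
Proof.
have dom := density_prob_dominates ah.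
have dh := density_density_prob ah.
have mh := adm_measurable ah.
have md := measurable_density dom.
rewrite (free_energyE dom); first congr EFin.
  exact: (ae_eq_energy md mh (L1_density dom) (adm_L1 ah) dh).
apply: (ae_eq_L1 _ _ _ (adm_entropy ah)).
- by apply: measurable_funTS; exact: measurable_xlnx_comp.
- by apply: measurable_funTS; exact: measurable_xlnx_comp.
- by apply: aeS dh => x /= fg' /fg' ->.
Qed.

Definition energy_minimiser (W h : R -> R) : Prop :=
  admissible h /\ forall g, admissible g -> energy W h <= energy W g.

(** The uniform measure has finite free energy, so a minimiser is absolutely
    continuous with an integrable entropy; the minimality among measures then
    becomes a minimality among admissible densities. *)
Lemma global_minimiser_density (P : probability TR R) :
  global_minimiser w gamma l P ->
  P `<< mu /\ energy_minimiser W (density P).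
Proof.
move=> [tP minP].
have [Pmu lP] : P `<< mu /\ L1 (xlnx \o density P).
  have := minP _ (torus_density_prob admissible1).
  rewrite free_energy_density_prob {1}/free_energy.
  by case: asboolP => //; rewrite leye_eq.
have aP : admissible (density P).
  split => //; [exact: measurable_density|exact: density_ge0|exact: L1_density|].
  exact: tint_density.
split; first exact: Pmu.
split=> [|g ag]; first exact: aP.
have := minP _ (torus_density_prob ag).
by rewrite free_energy_density_prob (free_energyE Pmu lP) lee_fin.
Qed.

End Energy.

(** * The Euler-Lagrange equation *)

Section Entropy.
Context {R : realType}.
Implicit Types (a b c t : R).

(** The graph of [x ln x] lies above its tangent at [c]: this is
    [1 + t <= exp t] at [t = ln (c / a)].  Integrated against densities, the gap
    is a relative entropy. *)
Lemma xlnx_tangent a c : 0 <= a -> 0 < c -> a * ln c + a - c <= xlnx a.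
Proof.
move=> + c0; rewrite le_eqVlt => /predU1P[<-|a0].
  by rewrite /xlnx !mul0r; lra.
have ca : 0 < c / a by rewrite divr_gt0.
have := expR_ge1Dx (ln (c / a)); rewrite lnK ?posrE// ln_div ?posrE//.
rewrite ler_pdivlMr// /xlnx; lra.
Qed.

Lemma xlnx_tangent_eq a c : 0 <= a -> 0 < c ->
  xlnx a = a * ln c + a - c -> a = c.
Proof.
move=> + c0; rewrite le_eqVlt => /predU1P[<-|a0].
  by rewrite /xlnx !mul0r; lra.
move=> ac; have ca : 0 < c / a by rewrite divr_gt0.
have := @expR_gt1Dx _ (ln (c / a)); rewrite lnK ?posrE// ln_div ?posrE//.
rewrite ltr_pdivlMr// subr_eq0; have [lnE _|_ /(_ isT)] := eqVneq (ln c) (ln a).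
  by apply: ln_inj => //; rewrite ?posrE.
by move: ac; rewrite /xlnx; lra.
Qed.

Lemma xlnx_ge a : 0 <= a -> -1 <= xlnx a.
Proof.
by move=> a0; have := xlnx_tangent a0 ltr01; rewrite ln1 mulr0; lra.
Qed.

Lemma xlnx_bounded a b : 0 <= a -> `|a| <= b ->
  `|xlnx a| <= 1 + (b + 1) * (b + 1).
Proof.
move=> a0; rewrite ger0_norm// => ab.
have BB : 0 <= (b + 1) * (b + 1) by apply: mulr_ge0; lra.
rewrite ler_norml; apply/andP; split; first by have := xlnx_ge a0; lra.
move: (a0); rewrite le_eqVlt => /predU1P[<-|a_gt0].
  by rewrite /xlnx mul0r; lra.
apply: (@le_trans _ _ (a * a)).
  by rewrite /xlnx ler_pM2l// ltW// ln_sublinear.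
have : a * a <= (b + 1) * (b + 1) by apply: ler_pM; lra.
lra.
Qed.

(** The convex combination of the tangent inequalities at the intermediate
    point. *)
Lemma xlnx_convex a b t : 0 <= a -> 0 < b -> 0 < t < 1 ->
  xlnx (a + t * (b - a)) <= xlnx a + t * (xlnx b - xlnx a).
Proof.
move=> a0 b0 /andP[t0 t1]; set c := a + _.
have c0 : 0 < c.
  rewrite (_ : c = (1 - t) * a + t * b); last by rewrite /c; ring.
  by rewrite ltr_wpDl ?mulr_ge0 ?mulr_gt0// subr_ge0 ltW.
have ha : 0 <= (1 - t) * (xlnx a - (a * ln c + a - c)).
  by rewrite mulr_ge0 ?subr_ge0 ?xlnx_tangent// ltW.
have hb : 0 <= t * (xlnx b - (b * ln c + b - c)).
  by rewrite mulr_ge0 ?subr_ge0 ?xlnx_tangent// ltW.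
rewrite -subr_ge0 (_ : _ - _ = (1 - t) * (xlnx a - (a * ln c + a - c)) +
   t * (xlnx b - (b * ln c + b - c))); first exact: addr_ge0.
have -> : xlnx c = c * ln c by [].
by move: (ln c) (xlnx a) (xlnx b) => L A B; rewrite /c; ring.
Qed.

(** The sign of a first variation. *)
Lemma quadratic_ge0 a b : (forall t, 0 < t < 1 -> 0 <= t * a + t ^+ 2 * b) -> 0 <= a.
Proof.
move=> H; rewrite leNgt; apply/negP => a0.
have b0 : 0 < `|b| + 1 by rewrite ltr_wpDl.
(* so small that the quadratic term is at most half of the linear one *)
pose t := Num.min 2^-1 (- a / (2 * (`|b| + 1))).
have t0 : 0 < t by rewrite lt_min invr_gt0 divr_gt0 ?mulr_gt0//; lra.
have t1 : t <= 2^-1 by rewrite ge_min lexx.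
have tb : t * (2 * (`|b| + 1)) <= - a.
  by rewrite -ler_pdivlMr ?mulr_gt0// ge_min lexx orbT.
have /H : 0 < t < 1 by lra.
rewrite expr2 -mulrA -mulrDr pmulr_rge0// => h.
have : t * b <= t * `|b| by rewrite ler_pM2l// ler_norm.
lra.
Qed.

End Entropy.

Section EulerLagrange.
Context {R : realType}.
Local Notation D := (`[0%R, 1%R]%classic : set R).
Variables (W : R -> R) (M K : R).
Hypothesis kW : torus_kernel W M K.
Implicit Types (f g h : R -> R).

(** The density proportional to [exp (- pot W h)], with the partition function
    inside the exponential so that its logarithm is immediate. *)
Definition gibbs (h : R -> R) (x : R) : R :=
  expR (- pot W h x - ln (tint (fun y => expR (- pot W h y)))).

Lemma gibbs_gt0 h x : 0 < gibbs h x.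
Proof. exact: expR_gt0. Qed.

Lemma gibbs_periodic h : periodic (gibbs h).
Proof. by move=> x n; rewrite /gibbs (pot_periodic kW). Qed.

Lemma continuous_gibbs h : L1 h -> continuous (gibbs h).
Proof.
move=> lh x; apply: continuous_comp; last exact: continuous_expR.
apply: cvgB; last exact: cvg_cst.
by apply: cvgN; exact: (continuous_pot kW).
Qed.

Lemma gibbs_bounded h : L1 h -> exists B, forall x, `|gibbs h x| <= B.
Proof.
move=> lh; exists (expR (M * tint (fun y => `|h y|) -
  ln (tint (fun y => expR (- pot W h y))))) => x.
rewrite ger0_norm ?expR_ge0// ler_expR lerD2r.
by have := pot_bounded kW x lh; rewrite ler_norml; lra.
Qed.

Lemma bounded_admissible (h : R -> R) (B : R) : measurable_fun setT h ->
  (forall x, 0 <= h x) -> (forall x, `|h x| <= B) -> tint h = 1 -> admissible h.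
Proof.
move=> mh h0 hB h1; split => //; first exact: L1_bounded hB.
apply: L1_bounded; first exact: measurable_xlnx_comp.
by move=> x; apply: (xlnx_bounded (h0 x) (hB x)).
Qed.

Lemma admissible_gibbs h : L1 h -> admissible (gibbs h).
Proof.
move=> lh; have [B hB] := gibbs_bounded lh.
have mg : measurable_fun setT (gibbs h).
  by apply: continuous_measurable_fun; exact: continuous_gibbs.
apply: (bounded_admissible mg _ hB) => [x|]; first exact/ltW/gibbs_gt0.
set C := M * tint (fun y => `|h y|).
have mV : measurable_fun setT (fun y : R => expR (- pot W h y)).
  apply: measurableT_comp; first exact: measurable_expR.
  by apply: measurableT_comp => //; exact: (measurable_pot kW).
have bV x : expR (- C) <= expR (- pot W h x) <= expR C.
  by have := pot_bounded kW x lh; rewrite !ler_expR ler_norml -/C; lra.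
have lV : L1 (fun y : R => expR (- pot W h y)).
  apply: (L1_bounded (M := expR C)) => // x.
  by rewrite ger0_norm ?expR_ge0//; case/andP: (bV x).
pose Z := tint (fun y => expR (- pot W h y)).
have Z0 : 0 < Z.
  apply: (@lt_le_trans _ _ (expR (- C))); first exact: expR_gt0.
  rewrite -(tint_cst (expR (- C))); apply: le_tint => //; first exact: L1_cst.
  by move=> x _; case/andP: (bV x).
transitivity (tint (fun x => Z^-1 * expR (- pot W h x))).
  by apply: eq_tint => x; rewrite /gibbs -/Z expRB lnK ?posrE// mulrC.
by rewrite tintZ// mulVf// gt_eqF.
Qed.

Lemma ln_gibbs h x :
  ln (gibbs h x) = - pot W h x - ln (tint (fun y => expR (- pot W h y))).
Proof. by rewrite expRK. Qed.

Section Variation.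
Variables (f g : R -> R).
Hypotheses (af : admissible f) (ag : admissible g) (g0 : forall x, 0 < g x).

Let lf := adm_L1 af.
Let lg := adm_L1 ag.
Let d x := g x - f x.
Let ld : L1 d. Proof. exact: L1B. Qed.
Let ht t x := f x + t * (g x - f x).

Let ht_ge0 t x : 0 < t < 1 -> 0 <= ht t x.
Proof.
move=> /andP[t0 t1]; rewrite /ht (_ : _ + _ = (1 - t) * f x + t * g x); last by ring.
by rewrite addr_ge0 ?mulr_ge0 ?(adm_ge0 af) ?(adm_ge0 ag)//; lra.
Qed.

Lemma admissible_segment t : 0 < t < 1 -> admissible (ht t).
Proof.
move=> t01; have mf := adm_measurable af; have mg := adm_measurable ag.
have mh : measurable_fun setT (ht t).
  apply: measurable_funD => //; apply: measurable_funM => //.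
  exact: measurable_funB.
split => //.
- by move=> x; exact: ht_ge0.
- by apply: L1D => //; exact: L1Z.
- rewrite /ht tintD//; last exact: L1Z.
  by rewrite tintZ// tintB// (adm_mass af) (adm_mass ag) subrr mulr0 addr0.
apply: (@L1_le _ _ (fun x => 1 + (`|xlnx (f x)| + `|xlnx (g x)|))).
- by apply: measurable_funTS; exact: measurable_xlnx_comp.
- move=> x _ /=; rewrite ler_norml; apply/andP; split.
    by have := xlnx_ge (ht_ge0 x t01); have := normr_ge0 (xlnx (f x));
       have := normr_ge0 (xlnx (g x)); lra.
  apply: le_trans (xlnx_convex (adm_ge0 af x) (g0 x) t01) _.
  rewrite (_ : _ + _ = (1 - t) * xlnx (f x) + t * xlnx (g x)); last by ring.
  have h1 : (1 - t) * xlnx (f x) <= `|xlnx (f x)|.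
    apply: (@le_trans _ _ ((1 - t) * `|xlnx (f x)|)).
      by apply: ler_wpM2l; [lra|exact: ler_norm].
    by rewrite ler_piMl//; lra.
  have h2 : t * xlnx (g x) <= `|xlnx (g x)|.
    apply: (@le_trans _ _ (t * `|xlnx (g x)|)).
      by apply: ler_wpM2l; [lra|exact: ler_norm].
    by rewrite ler_piMl//; lra.
  lra.
apply: L1D; first exact: L1_cst.
apply: L1D; apply: L1_norm; [exact: (adm_entropy af)|exact: (adm_entropy ag)].
Qed.

(** The entropy is convex along the segment and the interaction energy is
    quadratic, with the linear term given by the symmetry of the convolution. *)
Lemma energy_segment t : 0 < t < 1 ->
  energy W (ht t) <= energy W f +
   (t * (tint (xlnx \o g) - tint (xlnx \o f) + tint (fun x => d x * pot W f x)) +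
    t ^+ 2 * (2^-1 * tint (fun x => d x * pot W d x))).
Proof.
move=> t01; have eh := adm_entropy (admissible_segment t01).
have ef := adm_entropy af; have eg := adm_entropy ag.
have S : tint (xlnx \o ht t) <=
    tint (xlnx \o f) + t * (tint (xlnx \o g) - tint (xlnx \o f)).
  have -> : tint (xlnx \o f) + t * (tint (xlnx \o g) - tint (xlnx \o f)) =
      tint (fun x => xlnx (f x) + t * (xlnx (g x) - xlnx (f x))).
    rewrite tintD//; last by apply: L1Z; exact: L1B.
    by rewrite tintZ ?tintB//; exact: L1B.
  apply: le_tint => //; first by apply: L1D => //; apply: L1Z; exact: L1B.
  by move=> x _; apply: xlnx_convex => //; exact: adm_ge0.
have B : tint (fun x => ht t x * pot W (ht t) x) =
    tint (fun x => f x * pot W f x) + 2 * t * tint (fun x => d x * pot W f x) +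
    t ^+ 2 * tint (fun x => d x * pot W d x).
  transitivity (tint (fun x => (f x * pot W f x + t * (f x * pot W d x)) +
     (t * (d x * pot W f x) + t ^+ 2 * (d x * pot W d x)))).
    apply: eq_tint => x; rewrite /ht (potD kW)//; last exact: L1Z.
    by rewrite (potZ kW)// -/d /d; ring.
  have lff := L1_mul_pot kW lf lf; have lfd := L1_mul_pot kW lf ld.
  have ldf := L1_mul_pot kW ld lf; have ldd := L1_mul_pot kW ld ld.
  rewrite !tintD; try (by do ?[apply: L1D|apply: L1Z]).
  rewrite !tintZ; [|by do ?apply: L1Z..].
  rewrite (pot_symmetric kW lf ld).
  move: (tint _) (tint _) (tint _) => a b c; ring.
rewrite /energy B; move: S {B eh ef eg}.
move: (tint (xlnx \o ht t)) (tint (xlnx \o f)) (tint (xlnx \o g)) => et e0 e1.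
by move: (tint _) (tint _) (tint _) => a b c; lra.
Qed.

End Variation.

(** Minimality along the segment from [f] to its Gibbs density [g] makes the
    first variation nonnegative.  With [ln g = - pot W f - Z], the latter equals
    minus the relative entropy of [f] with respect to [g], which therefore
    vanishes; so does its nonnegative integrand, almost everywhere. *)
Lemma euler_lagrange f : energy_minimiser W f -> ae_eq_torus f (gibbs f).
Proof.
move=> [af minf]; have lf := adm_L1 af.
have ag := admissible_gibbs lf; have lg := adm_L1 ag.
set g := gibbs f in ag lg *.
have g0 x : 0 < g x by exact: gibbs_gt0.
set Z := ln (tint (fun y => expR (- pot W f y))).
have lng x : ln (g x) = - pot W f x - Z by exact: ln_gibbs.
have ef := adm_entropy af; have eg := adm_entropy ag.
have lfV := L1_mul_pot kW lf lf; have lgV := L1_mul_pot kW lg lf.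
have A0 : 0 <= tint (xlnx \o g) - tint (xlnx \o f) +
    tint (fun x => (g x - f x) * pot W f x).
  apply: (@quadratic_ge0 _ _ (2^-1 * tint (fun x => (g x - f x) *
     pot W (fun x => g x - f x) x))) => t t01.
  have := le_trans (minf _ (admissible_segment af ag g0 t01))
    (energy_segment af ag g0 t01).
  by rewrite lerDl.
have gE : tint (xlnx \o g) = - tint (fun x => g x * pot W f x) - Z.
  transitivity (tint (fun x => (- 1) * (g x * pot W f x) + (- Z) * g x)).
    by apply: eq_tint => x; rewrite /= /xlnx lng; ring.
  by rewrite tintD ?tintZ ?(adm_mass ag)//; [ring|exact: L1Z|exact: L1Z].
have fE : tint (fun x => f x * ln (g x)) = - tint (fun x => f x * pot W f x) - Z.
  transitivity (tint (fun x => (- 1) * (f x * pot W f x) + (- Z) * f x)).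
    by apply: eq_tint => x; rewrite /= lng; ring.
  by rewrite tintD ?tintZ ?(adm_mass af)//; [ring|exact: L1Z|exact: L1Z].
have lfg : L1 (fun x => f x * ln (g x)).
  rewrite (_ : (fun _ => _) = fun x => (- 1) * (f x * pot W f x) + (- Z) * f x).
    by apply: L1D; exact: L1Z.
  by apply/funext => x; rewrite lng; ring.
have dE : tint (fun x => (g x - f x) * pot W f x) =
    tint (fun x => g x * pot W f x) - tint (fun x => f x * pot W f x).
  by rewrite -tintB//; apply: eq_tint => x; rewrite mulrBl.
pose k x := xlnx (f x) - (f x * ln (g x) + f x - g x).
have lk : L1 k by apply: L1B => //; apply: L1B => //; exact: L1D.
have k0 x : 0 <= k x by rewrite subr_ge0 xlnx_tangent// (adm_ge0 af).
have : ae_eq_torus k (fun=> 0).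
  apply: tint_eq0_ae => //.
  rewrite /k tintB//; last by apply: L1B => //; exact: L1D.
  rewrite tintB//; last exact: L1D.
  rewrite tintD// fE (adm_mass af) (adm_mass ag).
  by move: A0; rewrite gE dE; lra.
apply: aeS => x /= kx /kx /eqP; rewrite subr_eq0 => /eqP kE.
exact: xlnx_tangent_eq (adm_ge0 af x) (g0 x) kE.
Qed.

End EulerLagrange.

(** * Polarization *)

Section ArcSign.
Context {R : realType}.

Lemma measurable_arc_sign : measurable_fun [set: R] (@arc_sign R).
Proof.
apply: measurable_fun_ifT => //; apply: measurable_fun_ltr => //.
apply: measurable_funB => //; apply: nondecreasing_measurable => //.
by move=> x y xy; rewrite ler_int; exact: le_floor.
Qed.

(** The reflection exchanges the two arcs, except for its fixed points, at which
    [2 y] is an integer. *)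
Lemma arc_signN (y : R) :
  arc_sign (- y) = - arc_sign y \/ exists n : int, y + y = n%:~R.
Proof.
have y0 := frac_ge0 y; have y1 := frac_lt1 y; have yE := fracK y.
have [f0|f0] := eqVneq (frac y) 0.
  right; exists (Num.floor y + Num.floor y); rewrite intrD; lra.
have [f2|f2] := eqVneq (frac y) 2^-1.
  by right; exists (Num.floor y + Num.floor y + 1); rewrite !intrD; lra.
left; have fpos : 0 < frac y by rewrite lt_neqAle eq_sym f0.
have -> : arc_sign (- y) = arc_sign (1 - frac y).
  rewrite -(arc_sign_periodic (1 - frac y) (- Num.floor y - 1)).
  by rewrite intrD !mulrNz; congr arc_sign; lra.
rewrite /arc_sign frac_id; [|lra..].
case: ltP => h1; case: ltP => h2; rewrite ?opprK//; exfalso; first by lra.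
by move/eqP: f2; apply; lra.
Qed.

End ArcSign.

Section Polarization.
Context {R : realType}.
Local Notation D := (`[0%R, 1%R]%classic : set R).
Variables (W : R -> R) (M K : R).
Hypothesis kW : torus_kernel W M K.
Variables (f : R -> R) (B s : R).
Hypotheses (cf : continuous f) (pf : periodic f) (f0 : forall x, 0 < f x).
Hypothesis fB : forall x, `|f x| <= B.
Hypothesis minf : energy_minimiser W f.

Let S x := f x + f (s - x).
Let u x := f x - f (s - x).
Let v x := arc_sign (x - s / 2) * `|u x|.
(** With the sum [S] and the difference [u] of [f] and its reflection, the larger
    of the two values is [(S + |u|) / 2] and the smaller one [(S - |u|) / 2]. *)
Definition polarized x := 2^-1 * (S x + v x).
Let g := polarized.

Let mf : measurable_fun setT f. Proof. exact: continuous_measurable_fun. Qed.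

Let mfs : measurable_fun setT (fun x : R => f (s - x)).
Proof. by apply: (measurableT_comp mf); exact: measurable_reflection. Qed.

Let pfs : periodic (fun x => f (s - x)).
Proof. by move=> x n; rewrite opprD addrA (periodicB pf). Qed.

Let mS : measurable_fun setT S. Proof. exact: measurable_funD. Qed.
Let m_u : measurable_fun setT u. Proof. exact: measurable_funB. Qed.
Let mv : measurable_fun setT v.
Proof.
apply: measurable_funM; last exact: measurableT_comp.
apply: measurableT_comp; first exact: measurable_arc_sign.
exact: measurable_funB.
Qed.

Let pS : periodic S. Proof. by move=> x n; rewrite /S pf (pfs x n). Qed.
Let pu : periodic u. Proof. by move=> x n; rewrite /u pf (pfs x n). Qed.
Let pv : periodic v.
Proof. by move=> x n; rewrite /v pu addrAC arc_sign_periodic. Qed.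

Let reflectionK x : s - (s - x) = x. Proof. by ring. Qed.

Let S_even x : S (s - x) = S x.
Proof. by rewrite /S reflectionK addrC. Qed.

Let u_odd x : u (s - x) = - u x.
Proof. by rewrite /u reflectionK opprB. Qed.

Let v_odd x : v (s - x) = - v x.
Proof.
rewrite /v u_odd normrN (_ : s - x - s / 2 = - (x - s / 2)); last by field.
have [->|[n nE]] := arc_signN (x - s / 2); first by rewrite mulNr.
suff -> : u x = 0 by rewrite normr0 !mulr0 oppr0.
rewrite /u (_ : s - x = x - n%:~R) ?(periodicB pf) ?subrr//.
by rewrite -nE; field.
Qed.

Let norm_v x : `|v x| = `|u x|.
Proof. by rewrite /v normrM normr_arc_sign mul1r normr_id. Qed.

Let SB x : `|S x| <= B + B.
Proof. by rewrite (le_trans (ler_normD _ _))// lerD. Qed.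

Let uB x : `|u x| <= B + B.
Proof. by rewrite (le_trans (ler_normB _ _))// lerD. Qed.

Let vB x : `|v x| <= B + B. Proof. by rewrite norm_v. Qed.

Let lS : L1 S. Proof. exact: L1_bounded SB. Qed.
Let lu : L1 u. Proof. exact: L1_bounded uB. Qed.
Let lv : L1 v. Proof. exact: L1_bounded vB. Qed.

Let g_choice x : (g x = f x /\ g (s - x) = f (s - x)) \/
                 (g x = f (s - x) /\ g (s - x) = f x).
Proof.
have h : v x = u x \/ v x = - u x.
  rewrite /v /arc_sign; case: ifP => _; case: (ger0P (u x)) => _;
  rewrite ?mul1r ?mulN1r ?opprK; by [left|right].
rewrite /g /polarized S_even v_odd.
by case: h => ->; [left|right]; rewrite /S /u; split; field.
Qed.

Lemma polarized_close x : `|polarized x - f x| <= `|u x|.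
Proof.
have [[gE _]|[gE _]] := g_choice x; rewrite -/g gE ?subrr ?normr0//.
by rewrite distrC.
Qed.

Let pot_S_even x : pot W S (s - x) = pot W S x.
Proof.
rewrite -(pot_reflection kW s x mS SB pS); congr (pot W _ _).
by apply/funext => y; rewrite S_even.
Qed.

Let pot_odd (p : R -> R) x : measurable_fun setT p -> (forall x, `|p x| <= B + B) ->
  periodic p -> (forall x, p (s - x) = - p x) -> pot W p (s - x) = - pot W p x.
Proof.
move=> mp pB pp op; have lp : L1 p by exact: L1_bounded pB.
rewrite -(pot_reflection kW s x mp pB pp) -mulN1r -(potZ kW)//.
by congr (pot W _ _); apply/funext => y; rewrite op mulN1r.
Qed.

(** Against odd functions, [W (x - y)] may be replaced by half of this kernel,
    whose sign only depends on the arcs of [x] and [y]. *)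
Let k x y := W (x - y) - W (s - x - y).

Let lk x (p : R -> R) : L1 p -> L1 (fun y => k x y * p y).
Proof.
move=> lp; rewrite (_ : (fun _ => _) =
  fun y => W (x - y) * p y - W (s - x - y) * p y); last first.
  by apply/funext => y; rewrite mulrBl.
by apply: L1B; exact: (L1_pot kW).
Qed.

Let pot_oddE (p : R -> R) x : measurable_fun setT p -> (forall x, `|p x| <= B + B) ->
  periodic p -> (forall x, p (s - x) = - p x) ->
  pot W p x = 2^-1 * tint (fun y => k x y * p y).
Proof.
move=> mp pB pp op; have lp : L1 p by exact: L1_bounded pB.
have -> : tint (fun y => k x y * p y) = pot W p x - pot W p (s - x).
  rewrite -tintB; [|exact: (L1_pot kW)..].
  by apply: eq_tint => y; rewrite mulrBl.
by rewrite pot_odd//; field.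
Qed.

Let k_sign x y : arc_sign (x - s / 2) * arc_sign (y - s / 2) * k x y <= 0.
Proof.
have := tdist_sub_add (x - s / 2) (y - s / 2).
rewrite (_ : x - s / 2 - (y - s / 2) = x - y); last by field.
rewrite (_ : x - s / 2 + (y - s / 2) = - (s - x - y)); last by field.
rewrite tdistN /k => H.
have e : arc_sign (x - s / 2) * arc_sign (y - s / 2) = 1 \/
         arc_sign (x - s / 2) * arc_sign (y - s / 2) = -1.
  by rewrite /arc_sign; do 2 case: ifP => _;
    rewrite ?mulrNN ?mulr1 ?mul1r; [left|right|right|left].
case: e H => ->; rewrite ?mul1r ?mulN1r ?oppr_ge0 ?oppr_le0 ?subr_ge0 ?subr_le0;
  exact: kernel_mono kW _ _.
Qed.

(** Both sides are half the integral of [k x y] against [v x * v y] and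
    [u x * u y]; these products have the same absolute value, and the first one
    has the sign opposite to that of [k x y]. *)
Let pot_compare x : v x * pot W v x <= u x * pot W u x.
Proof.
rewrite !pot_oddE// ![_ x * (2^-1 * _)]mulrCA ler_pM2l ?invr_gt0//.
rewrite -!tintZ; [|exact: lk..].
apply: le_tint; [by apply: L1Z; exact: lk..|] => y _.
rewrite -subr_ge0 /v.
have := k_sign x y; have : `|arc_sign (x - s / 2) * arc_sign (y - s / 2)| = 1.
  by rewrite normrM !normr_arc_sign mulr1.
set e := _ * _ => e1 ek.
have ee : e * e = 1.
  by rewrite -expr2 -real_normK ?num_real// e1 expr1n.
have -> : u x * (k x y * u y) -
  arc_sign (x - s / 2) * `|u x| * (k x y * (arc_sign (y - s / 2) * `|u y|)) =
  (e * k x y) * (e * (u x * u y) - `|u x * u y|).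
  rewrite normrM [RHS]mulrBr (_ : e * k x y * (e * _) = e * e * (k x y * (u x * u y))).
    by rewrite ee mul1r /e; ring.
  by ring.
apply: mulr_le0 => //; rewrite subr_le0.
by rewrite -[leRHS]mul1r -e1 -normrM ler_norm.
Qed.

Let self_interaction (p : R -> R) : measurable_fun setT p ->
  (forall x, `|p x| <= B + B) -> periodic p -> (forall x, p (s - x) = - p x) ->
  tint (fun x => 2^-1 * (S x + p x) * pot W (fun y => 2^-1 * (S y + p y)) x) =
  2^-1 ^+ 2 * (tint (fun x => S x * pot W S x) + tint (fun x => p x * pot W p x)).
Proof.
move=> mp pB pp op; have lp : L1 p by exact: L1_bounded pB.
have lSS := L1_mul_pot kW lS lS; have lSp := L1_mul_pot kW lS lp.
have lpS := L1_mul_pot kW lp lS; have lpp := L1_mul_pot kW lp lp.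
(* the cross term is odd under the reflection, hence has integral 0 *)
pose q x := S x * pot W p x.
have q0 : tint q = 0.
  have mq : measurable_fun setT q.
    by apply: measurable_funM => //; exact: (measurable_pot kW).
  have qB x : `|q x| <= (B + B) * (M * tint (fun y => `|p y|)).
    by rewrite normrM ler_pM//; exact: (pot_bounded kW).
  have pq : periodic q by move=> x n; rewrite /q pS (pot_periodic kW).
  have := tint_reflection s mq qB pq.
  rewrite (_ : (fun x => q (s - x)) = fun x => (-1) * q x); last first.
    by apply/funext => x; rewrite /q S_even pot_odd//; ring.
  by rewrite tintZ//; lra.
transitivity (tint (fun x => 2^-1 ^+ 2 * ((S x * pot W S x + p x * pot W p x) +
    (q x + p x * pot W S x)))).
  apply: eq_tint => x; rewrite (potZ kW); last exact: L1D.
  by rewrite (potD kW)// /q; ring.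
rewrite tintZ; last by do 2 apply: L1D => //; apply: L1D.
rewrite tintD; [|exact: L1D|exact: L1D].
by rewrite !tintD// (pot_symmetric kW lp lS) -/q q0 !addr0.
Qed.

Let f_half : f = fun x => 2^-1 * (S x + u x).
Proof. by apply/funext => x; rewrite /S /u; field. Qed.

Lemma polarized_gt0 x : 0 < g x.
Proof. by have [[->]|[->]] := g_choice x. Qed.

Let gB x : `|g x| <= B.
Proof. by have [[->]|[->]] := g_choice x. Qed.

Let mg : measurable_fun setT g.
Proof. by apply: measurable_funM => //; exact: measurable_funD. Qed.

Let pg : periodic g.
Proof. by move=> x n; rewrite /g /polarized pS pv. Qed.

Let tint_rearranged (F : R -> R) (C : R) : measurable_fun setT F ->
  (forall x, 0 <= x -> `|x| <= B -> `|F x| <= C) -> tint (F \o g) = tint (F \o f).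
Proof.
move=> mF FC.
have half (h : R -> R) : measurable_fun setT h -> periodic h ->
    (forall x, 0 < h x) -> (forall x, `|h x| <= B) ->
    tint (F \o h) = 2^-1 * tint (fun x => F (h x) + F (h (s - x))).
  move=> mh ph h0 hB.
  have mFh : measurable_fun setT (F \o h) by exact: measurableT_comp.
  have FhC x : `|(F \o h) x| <= C by apply: FC => //; exact: ltW.
  have pFh : periodic (F \o h) by move=> x n /=; rewrite ph.
  rewrite tintD; last 2 first.
  - exact: L1_bounded FhC.
  - apply: (@L1_bounded _ C); last by move=> x; exact: (FhC (s - x)).
    by apply: (measurableT_comp mFh); exact: measurable_reflection.
  have := tint_reflection s mFh FhC pFh; rewrite /comp => ->.
  by field.
rewrite (half g)//; last exact: polarized_gt0.
rewrite (half f)//; congr (_ * _); apply: eq_tint => x.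
by have [[-> ->]|[-> ->]] := g_choice x; rewrite // addrC.
Qed.

(** At [x] and [s - x] together, the polarization takes the same two values as
    [f], which preserves the mass and the entropy.  In the interaction energy, the
    even part [S] contributes the same amount and is decoupled from the odd part;
    the odd parts are compared pointwise in [pot_compare]. *)
Lemma polarized_minimiser : energy_minimiser W polarized.
Proof.
have [af fmin] := minf.
have ag : admissible g.
  apply: (bounded_admissible mg _ gB) => [x|]; first exact/ltW/polarized_gt0.
  by rewrite (tint_rearranged (F := id) (C := B))// (adm_mass af).
split=> [|h ah]; first exact: ag.
apply: le_trans (fmin h ah).
rewrite /energy (tint_rearranged (F := @xlnx R) (C := 1 + (B + 1) * (B + 1))).
- rewrite lerD2l ler_pM2l ?invr_gt0// [leRHS](_ : _ = tint (fun x =>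
    2^-1 * (S x + u x) * pot W (fun y => 2^-1 * (S y + u y)) x)); last first.
    by rewrite -f_half; apply: eq_tint => x; rewrite {1}f_half.
  rewrite (self_interaction mv vB pv v_odd) (self_interaction m_u uB pu u_odd).
  rewrite ler_pM2l ?exprn_gt0 ?invr_gt0// lerD2l.
  apply: le_tint; [exact: (L1_mul_pot kW)..|by move=> x _; exact: pot_compare].
- exact: measurable_xlnx.
- by move=> x; exact: xlnx_bounded.
Qed.

Let cu : continuous u.
Proof.
move=> x; apply: cvgB; first exact: cf.
apply: continuous_comp; last exact: cf.
by apply: cvgB; [exact: cvg_cst|exact: cvg_id].
Qed.

Let polarized_continuous_at q : u q = 0 -> {for q, continuous g}.
Proof.
move=> uq; have gq : g q = f q.
  by apply/eqP; rewrite -subr_eq0 -normr_le0 (le_trans (polarized_close q))// uq normr0.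
apply/cvgrPdist_lt => e e0; rewrite gq.
have e20 : 0 < e / 2 by rewrite divr_gt0.
have /cvgrPdist_lt/(_ _ e20) H1 := @cf q.
have /cvgrPdist_lt/(_ _ e20) H2 := @cu q.
near=> y.
have h1 : `|f q - f y| < e / 2 by near: y.
have h2 : `|u q - u y| < e / 2 by near: y.
have h3 := polarized_close y; rewrite -/g in h3.
rewrite uq sub0r normrN in h2.
rewrite (_ : f q - g y = (f q - f y) - (g y - f y)); last by ring.
by rewrite (le_lt_trans (ler_normB _ _))//; lra.
Unshelve. all: by end_near. Qed.

(** The third step of the proof.  The polarization is squeezed between [f] and
    its reflection, hence continuous wherever these agree, so that its
    Euler-Lagrange equation holds exactly at [q] and at [s - q]. *)
Lemma polarization_rigidity q : 0 < frac (q - s / 2) < 2^-1 -> f q = f (s - q) ->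
  \forall y \near q, f y = f (s - y).
Proof.
move=> /andP[q0 q1] /eqP; rewrite -subr_eq0 => /eqP; rewrite -/(u q) => uq.
have [ag _] := polarized_minimiser; have lg : L1 g := adm_L1 ag.
have EL := euler_lagrange kW polarized_minimiser.
have gibbs_eq z : u z = 0 -> gibbs W g z = f z.
  move=> uz; have <- : g z = f z.
    apply/eqP; rewrite -subr_eq0 -normr_le0.
    by rewrite (le_trans (polarized_close z))// uz normr0.
  apply/esym; apply: (ae_eq_torus_periodic_eq EL) => //.
  - exact: (gibbs_periodic kW).
  - exact: polarized_continuous_at.
  - exact: (continuous_gibbs kW).
have potg z : pot W g z = 2^-1 * (pot W S z + pot W v z).
  rewrite /g /polarized (potZ kW); last exact: L1D.
  by rewrite (potD kW).
(* the even part of the polarization has the same potential at both points *)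
have pv0 : pot W v q = 0.
  have : ln (gibbs W g q) = ln (gibbs W g (s - q)).
    rewrite !gibbs_eq ?u_odd ?uq ?oppr0//.
    by congr ln; apply/eqP; rewrite -subr_eq0; apply/eqP.
  rewrite !ln_gibbs !potg pot_S_even (pot_odd (p := v))//; lra.
have eq1 : arc_sign (q - s / 2) = 1 by rewrite /arc_sign q1.
have kv0 : ae_eq_torus (fun y => - (k q y * v y)) (fun=> 0).
  apply: tint_eq0_ae.
  - by apply: L1N; exact: lk.
  - move=> y _; rewrite oppr_ge0 /v mulrA.
    have := k_sign q y; rewrite eq1 mul1r mulrC => h.
    exact: mulr_le0_ge0.
  - rewrite (_ : (fun _ => _) = fun y => (-1) * (k q y * v y)); last first.
      by apply/funext => y; rewrite mulN1r.
    by rewrite tintZ; [have := pv0; rewrite pot_oddE//; lra|exact: lk].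
have ck : continuous (k q).
  move=> y; apply: cvgB; apply: continuous_comp;
    [|exact: (continuous_kernel kW)| |exact: (continuous_kernel kW)];
  by apply: cvgB; [exact: cvg_cst|exact: cvg_id].
have ku0 y : k q y * u y = 0.
  apply/eqP; rewrite -normr_eq0; apply/eqP.
  apply: (@ae_eq_torus_periodic_eq _ (fun y => `|k q y * u y|) (fun=> 0)).
  - apply: aeS kv0 => z /= kz /kz /eqP; rewrite oppr_eq0 => /eqP kz0.
    by rewrite normrM -norm_v -normrM kz0 normr0.
  - move=> z n; rewrite pu /k; congr (`|_ * _|).
    by rewrite !opprD !addrA !(periodicB (kernel_periodic kW)).
  - by [].
  - apply: continuous_comp; last exact: norm_continuous.
    by apply: cvgM; [exact: ck|exact: cu].
  - exact: cvg_cst.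
(* [q] is not a fixed point of the reflection *)
have kqq : k q q != 0.
  rewrite /k subrr lt_eqF// subr_lt0; apply: (kernel_strict kW).
  rewrite lt_neqAle tdist_ge0 andbT eq_sym; apply/eqP => /tdist_eq0[n nE].
  have qE := fracK (q - s / 2).
  pose m := - n - Num.floor (q - s / 2) - Num.floor (q - s / 2).
  have mE : m%:~R = frac (q - s / 2) + frac (q - s / 2).
    by rewrite /m !intrD !mulrNz -nE; lra.
  have : (0 : int) < m < 1 by rewrite -(ltr_int R) -(ltrz1 R) mE; lra.
  by case: (m) => [[|k0]|k0].
have : \forall y \near q, k q y != 0.
  exact: (cvgr_neq0 _ (ck q)).
apply: filterS => y ky; have /eqP := ku0 y.
by rewrite mulf_eq0 (negPf ky)/= subr_eq0 => /eqP.
Qed.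

End Polarization.

(** * Symmetry of the continuous minimiser *)

Section Symmetry.
Context {R : realType}.
Local Notation mu := (@lebesgue_measure R).
Variables (f : R -> R).
Hypotheses (cf : continuous f) (pf : periodic f).
Hypothesis rigid : forall s q, 0 < frac (q - s / 2) < 2^-1 -> f q = f (s - q) ->
  \forall y \near q, f y = f (s - y).

(** A change of sign of [f x - f (2 c - x)] would produce a zero inside the arc;
    by rigidity the zeros form an open and closed subset of the arc, hence the
    whole arc. *)
Lemma arc_dichotomy (c a b : R) : c < a < c + 2^-1 -> c < b < c + 2^-1 ->
  f a < f (c + c - a) -> f b < f (c + c - b).
Proof.
move=> ha hb fa; rewrite ltNge; apply/negP => fb.
pose u x := f x - f (c + c - x).
have cu : continuous u.
  move=> x; apply: cvgB; first exact: cf.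
  apply: continuous_comp; last exact: cf.
  by apply: cvgB; [exact: cvg_cst|exact: cvg_id].
have [z hz uz] : exists2 z, c < z < c + 2^-1 & u z = 0.
  have [ab|ba] := leP a b.
    have [|z + <-] := @IVT _ u a b 0 ab (continuous_subspaceT cu).
      by rewrite ge_min le_max /u; lra.
    by rewrite in_itv/= => zab; exists z; lra.
  have [|z + <-] := @IVT _ u b a 0 (ltW ba) (continuous_subspaceT cu).
    by rewrite ge_min le_max /u; lra.
  by rewrite in_itv/= => zab; exists z; lra.
pose A : set R := `]c, (c + 2^-1)[%classic.
pose U : set R := u @^-1` [set 0].
have cA : connected A by apply/connected_intervalP; exact: interval_is_interval.
have : A `&` U = A.
  apply: cA.
  - by exists z; split => //; rewrite /A /= in_itv.
  - exists (A `&` interior U).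
      by apply: openI; [exact: interval_open|exact: open_interior].
    apply/seteqP; split => x [Ax].
      move=> Ux; split => //; split => //.
      move: Ux; rewrite /U /= /u => /eqP; rewrite subr_eq0 => /eqP Ux.
      apply: filterS (rigid _ Ux) => [y yE|].
        by rewrite /U /= /u yE subrr.
      move: Ax; rewrite /A /= in_itv/= (_ : (c + c) / 2 = c); last by field.
      by move=> /andP[xc xc2]; rewrite frac_id; lra.
    by move=> [_ /interior_subset Ux].
  - exists U => //; apply: closed_comp; last exact: closed_eq.
    by move=> x _; exact: cu.
move/seteqP => [_ /(_ a)]; rewrite /A /U /= in_itv/= /u => /(_ ha) [_]; lra.
Qed.

Variable m : R.
Hypothesis f_max : forall x, f x <= f m.

Lemma tdist_half_integer (a b : R) (n : int) : a + a = n%:~R ->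
  tdist (a + b) = tdist (a - b).
Proof.
move=> aE; rewrite -(tdistN (a - b)) -(tdist_periodic (- (a - b)) n) -aE.
by congr tdist; ring.
Qed.

(** The reflection exchanging [x] and [y] is the one about [c = (x + y) / 2];
    [a] and [b] are the positions of [x] and [m] relative to [c].  The distances
    to [m] being different, neither [a] nor [b] is a fixed point, and
    [tdist_sub_add] puts them on the same arc. *)
Lemma decreasing_strict (x y : R) : tdist (x - m) < tdist (y - m) -> f y <= f x.
Proof.
move=> xym; rewrite leNgt; apply/negP => fxy.
pose c := (x + y) / 2; pose a := x - c; pose b := m - c.
have xE : x = c + a by rewrite /a; ring.
have mE : m = c + b by rewrite /b; ring.
have yE : y = c - a by rewrite /a /c; field.
have ab : tdist (a - b) < tdist (a + b).
  move: xym; rewrite (_ : x - m = a - b); last by rewrite xE mE; ring.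
  by rewrite -[tdist (y - m)]tdistN (_ : - (y - m) = a + b)//; rewrite yE mE; ring.
have na (n : int) : a + a <> n%:~R.
  by move=> aE; move: ab; rewrite (tdist_half_integer b aE) ltxx.
have nb (n : int) : b + b <> n%:~R.
  move=> bE; move: ab.
  by rewrite (addrC a b) (tdist_half_integer a bE) -tdistN opprB ltxx.
have nfrac (z : R) : (forall n : int, z + z <> n%:~R) -> frac z != 0 /\ frac z != 2^-1.
  move=> nz; have zE := fracK z; split; apply/eqP => fz.
    by apply: (nz (Num.floor z + Num.floor z)); rewrite intrD; lra.
  by apply: (nz (Num.floor z + Num.floor z + 1)); rewrite !intrD; lra.
have := frac_ge0 a; have := frac_lt1 a; have := fracK a.
have := frac_ge0 b; have := frac_lt1 b; have := fracK b.
have [/eqP a0 /eqP a2] := nfrac _ na; have [/eqP b0 /eqP b2] := nfrac _ nb.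
have := tdist_sub_add a b; rewrite /arc_sign.
set fa := frac a in a0 a2 *; set fb := frac b in b0 b2 *.
set ia := Num.floor a; set ib := Num.floor b.
have faE : a = fa + ia%:~R by rewrite /fa fracK.
have fbE : b = fb + ib%:~R by rewrite /fb fracK.
have fx : f (c + fa) = f x.
  by rewrite -[RHS](periodicB pf _ ia); congr f; lra.
have fy : f (c - fa) = f y by rewrite -[RHS](pf _ ia); congr f; lra.
have fm : f (c + fb) = f m.
  by rewrite -[RHS](periodicB pf _ ib); congr f; lra.
have pf1 z : f (z + 1) = f z by rewrite -(pf z 1).
case: ltP => ha; case: ltP => hb; rewrite ?mulrNN ?mulr1 ?mul1r ?mulN1r;
  move=> H bE b1 b0' aE a1 a0'.
- have h := @arc_dichotomy c (c + fa) (c + fb).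
  rewrite (_ : c + c - (c + fa) = c - fa) in h; last by ring.
  rewrite (_ : c + c - (c + fb) = c - fb) in h; last by ring.
  rewrite fx fy fm in h.
  have : f m < f (c - fb) by apply: h => //; lra.
  by rewrite ltNge f_max.
- by move: H; rewrite oppr_ge0 subr_le0 leNgt ab.
- by move: H; rewrite oppr_ge0 subr_le0 leNgt ab.
(* the arc that contains both points starts at the antipode of [c] *)
- have h := @arc_dichotomy (c + 2^-1) (c + fa) (c + fb).
  rewrite (_ : c + 2^-1 + (c + 2^-1) - (c + fa) = c - fa + 1) in h; last by field.
  rewrite (_ : c + 2^-1 + (c + 2^-1) - (c + fb) = c - fb + 1) in h; last by field.
  rewrite !pf1 fx fy fm in h.
  have : f m < f (c - fb) by apply: h => //; lra.
  by rewrite ltNge f_max.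
Qed.

(** In the case of equal distances, [x] is approached by points strictly closer
    to [m]. *)
Lemma decreasing (x y : R) : tdist (x - m) <= tdist (y - m) -> f y <= f x.
Proof.
rewrite le_eqVlt => /orP[/eqP xy|]; last exact: decreasing_strict.
have [n nE] := tdist_attained (x - m).
have := tdist_ge0 (x - m); rewrite le_eqVlt => /predU1P[|r0].
  move/esym/tdist_eq0 => [k kE].
  by rewrite (_ : x = m + k%:~R) ?pf// -kE; ring.
rewrite leNgt; apply/negP => fxy.
have : 0 < f y - f x by rewrite subr_gt0.
move/cvgrPdist_lt: (@cf x) => /[apply] /nbhs_ballP[e /= e0 He].
pose d := x - m - n%:~R; pose r := tdist (x - m).
pose t := Num.min 2^-1 (e / (2 * r)).
have r0' : 0 < r by [].
have t0 : 0 < t by rewrite lt_min divr_gt0 ?mulr_gt0//; lra.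
have t1 : t <= 2^-1 by rewrite ge_min lexx.
have tr : t * (2 * r) <= e by rewrite -ler_pdivlMr ?mulr_gt0// ge_min lexx orbT.
(* [x] moved towards the copy [m + n] of [m] that is nearest to it *)
pose x' := x - t * d.
have dE : `|d| = r by rewrite /d -nE.
have : `|f x - f x'| < f y - f x.
  apply: He; rewrite /x' /ball /= opprB addrC subrK normrM gtr0_norm// dE.
  have : 0 < t * r by rewrite mulr_gt0.
  by lra.
have : f y <= f x'.
  apply: decreasing_strict; rewrite -xy; apply: le_lt_trans (tdist_le _ n) _.
  rewrite (_ : x' - m - n%:~R = (1 - t) * d); last by rewrite /x' /d; ring.
  rewrite normrM dE ger0_norm; last by lra.
  by rewrite -/r gtr_pMl//; lra.
by rewrite ltr_norml; lra.
Qed.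

End Symmetry.

(** * Rearrangement of a density *)

Section Measures.
Context {R : realType}.
Local Notation mu := (@lebesgue_measure R).
Local Notation D := (`[0%R, 1%R]%classic : set R).

Lemma tint_translation (M a : R) (h : R -> R) : measurable_fun setT h ->
  (forall x, `|h x| <= M) -> periodic h -> tint (fun x => h (x + a)) = tint h.
Proof.
move=> mh hM ph; pose k x := h (a - x).
have mk : measurable_fun setT k.
  by apply: (measurableT_comp mh); exact: measurable_reflection.
have pk : periodic k by move=> x n; rewrite /k opprD addrA (periodicB ph).
rewrite -(tint_reflection a mh hM ph) -(tint_reflection (M := M) 0 mk _ pk); last first.
  by move=> x; exact: hM.
by apply: eq_tint => x; rewrite /k sub0r opprK addrC.
Qed.

Lemma superlevel_measure (h : R -> R) (t : R) : measurable_fun setT h ->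
  mu (torus `&` [set x | t < h x]) = (tint (fun x => (t < h x)%R%:R))%:E.
Proof.
move=> mh; pose A := h @^-1` `]t, +oo[%classic.
have AE : [set x | t < h x] = A.
  by apply/seteqP; split => x; rewrite /A /= in_itv/= andbT.
have mA : measurable (A : set (measurableTypeR R)).
  by rewrite -[A]setTI; apply: mh => //; exact: measurable_itv.
have indE x : \1_A x = (t < h x)%R%:R :> R.
  rewrite indicE (_ : (x \in A) = (t < h x)%R)// -AE.
  by apply/idP/idP; rewrite inE.
have mI : measurable_fun setT (fun x : R => (t < h x)%R%:R : R).
  rewrite (_ : (fun _ => _) = \1_A); first exact/measurable_indicP.
  by apply/funext => x; rewrite indE.
rewrite EFin_tint; last first.
  by apply: (L1_bounded (M := 1)) => // x; case: (t < h x); rewrite ?normr1 ?normr0.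
rewrite AE setIC -(integral_indic _ _ mA); last exact: measurable_itv.
rewrite /torus integral_itv_bndo_bndc.
  by apply: eq_integral => x _; rewrite indE.
by apply/measurable_EFinP; apply: measurable_funTS; exact/measurable_indicP.
Qed.

(** A translation of the circle preserves the measure of the superlevel sets. *)
Lemma density_rearrangement (f h : R -> R) (B m : R) :
  continuous f -> periodic f -> (forall x, 0 < f x) -> (forall x, `|f x| <= B) ->
  (forall x y, tdist (x - m) <= tdist (y - m) -> f y <= f x) ->
  measurable_fun setT h -> ae_eq_torus h f ->
  is_rearrangement h (fun x => f (x + m)).
Proof.
move=> cf pf f0 fB fm mh hf.
have mf : measurable_fun setT f by exact: continuous_measurable_fun.
have mfm : measurable_fun setT (fun x : R => f (x + m)).
  by apply: (measurableT_comp mf); apply: measurable_funD.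
have dist0 (x : R) : torus_dist x 0 = tdist (x + m - m).
  by rewrite /torus_dist subr0 addrK.
split.
- exact: measurable_funTS.
- by move=> x _; exact: ltW.
- move=> x y _ _; rewrite !dist0 => xy.
  by apply/eqP; rewrite eq_le !fm// xy.
- by move=> x y _ _; rewrite !dist0 => xy; exact: fm.
move=> t _; rewrite !superlevel_measure//; congr EFin.
have mI (k : R -> R) : measurable_fun setT k ->
    measurable_fun setT (fun x : R => (t < k x)%R%:R : R).
  move=> mk; rewrite (_ : (fun _ => _) = fun x => if t < k x then 1 else 0); last first.
    by apply/funext => x; case: ifP.
  by apply: measurable_fun_ifT => //; exact: measurable_fun_ltr.
transitivity (tint (fun x => (t < f x)%R%:R)).
  apply: (@tint_translation 1 m (fun x => (t < f x)%R%:R)).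
  - exact: mI.
  - by move=> x; case: (t < f x); rewrite ?normr1 ?normr0.
  - by move=> x n; rewrite pf.
apply: ae_eq_tint; [by apply: measurable_funTS; exact: mI..|].
by apply: aeS hf => x /= hf /hf ->.
Qed.

Lemma periodic_max (f : R -> R) : continuous f -> periodic f ->
  exists m, forall x, f x <= f m.
Proof.
move=> cf pf; have [m _ fm] := EVT_max ler01 (continuous_subspaceT cf).
exists m => x; rewrite -(periodic_frac x pf); apply: fm.
by rewrite in_itv/= frac_ge0 ltW// frac_lt1.
Qed.

End Measures.

(** * The interaction potential *)

Section Kernel.
Context {R : realType}.
Variables (w : R -> R) (sw gamma l : R).
Hypotheses (hA : assumptionA w sw) (gamma0 : 0 < gamma) (l0 : 0 < l).

(** The potential is a function of the geodesic distance, because [w] is even. *)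
Lemma potential_tdist x : potential w gamma l x = gamma * l * w (tdist x / l).
Proof.
rewrite /potential tdist_round; congr (_ * _).
have w_norm z : w `|z| = w z.
  by case: (ger0P z) => // _; rewrite (A_even hA).
by rewrite -[RHS]w_norm normrM normr_id -normrM w_norm.
Qed.

(** If [w r = w 0], monotonicity makes [w] constant on [[-r, r]], against the
    positive curvature at 0. *)
Lemma strict_minimum r : 0 < r -> w 0 < w r.
Proof.
move=> r0; rewrite lt_neqAle (A_min hA) andbT; apply/eqP => w0r.
have wE x : `|x| < r -> w x = w 0.
  move=> xr; have -> : w x = w `|x|.
    by case: (ger0P x) => // _; rewrite (A_even hA).
  apply/eqP; rewrite eq_le (A_min hA) andbT w0r.
  by apply: (A_nondecreasing hA) => //; exact: ltW.
have near_w x : `|x| < r -> \forall y \near x, w y = cst (w 0) y.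
  move=> xr; apply/nbhs_ballP; exists (r - `|x|) => /=; first by rewrite subr_gt0.
  move=> y; rewrite /ball /= => xy; apply: wE.
  have := ler_normD (y - x) x; rewrite subrK distrC; lra.
have w1 x : `|x| < r -> w^`() x = 0.
  by move=> xr; rewrite derive1E (near_eq_derive _ (near_w _ xr)) derive_cst.
have := A_curvature hA; rewrite derive1nS derive1n1 derive1E.
rewrite (near_eq_derive (g := cst 0)); first by rewrite derive_cst ltxx.
apply/nbhs_ballP; exists r => //= y; rewrite /ball /= sub0r normrN => yr.
by rewrite w1.
Qed.

Lemma potential_kernel : exists M K, torus_kernel (potential w gamma l) M K.
Proof.
have [k lipw] := A_lipschitz hA.
have lip x y : `|w x - w y| <= k * `|x - y| by exact: (lipw (x, y)).
have k0 : 0 <= k.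
  by have := lip 1 0; rewrite subr0 normr1 mulr1; apply: le_trans.
have gl0 : 0 < gamma * l by rewrite mulr_gt0.
exists (gamma * l * `|w 0|), (gamma * k); split.
- by move=> x; rewrite !potential_tdist tdistN.
- by move=> x n; rewrite !potential_tdist tdist_periodic.
- move=> x; rewrite potential_tdist normrM (gtr0_norm gl0) ler_pM2l//.
  by rewrite !ler0_norm ?(A_le0 hA)// lerN2 (A_min hA).
- move=> x y; rewrite !potential_tdist -mulrBr normrM (gtr0_norm gl0).
  apply: (@le_trans _ _ (gamma * l * (k * (`|x - y| / l)))).
    rewrite ler_pM2l//; apply: le_trans (lip _ _) _; apply: ler_wpM2l => //.
    rewrite -mulrBl normrM (gtr0_norm (x := l^-1)) ?invr_gt0//.
    by rewrite ler_wpM2r ?invr_ge0 ?(ltW l0)// tdist_lipschitz.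
  by rewrite le_eqVlt; apply/orP; left; apply/eqP; field; rewrite gt_eqF.
- move=> x y xy; rewrite !potential_tdist ler_pM2l//.
  apply: (A_nondecreasing hA); first by rewrite divr_ge0 ?tdist_ge0// ltW.
  by rewrite ler_wpM2r// invr_ge0 ltW.
- move=> x x0; rewrite !potential_tdist ltr_pM2l//.
  rewrite tdist01 // subr0 /Num.min ltr01 mul0r.
  by apply: strict_minimum; rewrite divr_gt0.
Qed.

End Kernel.

(** * Symmetry of the minimisers *)

Theorem theorem3p4 (R : realType) (w : R -> R) (sw gamma l : R)
    (P : probability (measurableTypeR R) R)
    (hA : assumptionA w sw)
    (hC2 : C2_on `]- sw, sw[ w)
    (hgamma : 0 < gamma)
    (hl0 : 0 < l)
    (hl : l < 1 / (2 * sw))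
    (hP : global_minimiser w gamma l P) :
  P `<< @lebesgue_measure R /\
  exists rho_star : R -> R,
    is_rearrangement (density P) rho_star /\
    exists a : R,
      {ae @lebesgue_measure R, forall x, torus x ->
        density P x = rho_star (torus_translation a x)}.
Proof.
have [M [K kW]] := potential_kernel hA hgamma hl0.
have [Pmu minP] := global_minimiser_density kW hP; split => //.
have EL := euler_lagrange kW minP.
have [aP _] := minP; have lP := adm_L1 aP.
(* the continuous version of the density has the same energy *)
set W := potential w gamma l in kW minP EL *.
set f := gibbs W (density P) in EL.
have af : admissible f by exact: (admissible_gibbs kW lP).
have minf : energy_minimiser W f.
  split=> [|h ah]; first exact: af.
  rewrite -(ae_eq_energy kW (adm_measurable aP) (adm_measurable af) lP
            (adm_L1 af) EL).
  exact: (proj2 minP).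
have cf : continuous f by exact: (continuous_gibbs kW).
have pf : periodic f by exact: (gibbs_periodic kW).
have f0 x : 0 < f x by exact: gibbs_gt0.
have [B fB] := gibbs_bounded kW lP.
have rigid s q := @polarization_rigidity _ _ _ _ kW f B s cf pf f0 fB minf q.
have [m f_max] := periodic_max cf pf.
exists (fun x => f (x + m)); split.
  apply: (density_rearrangement cf pf f0 fB _ (adm_measurable aP) EL).
  exact: (decreasing cf pf rigid f_max).
exists (- m); apply: aeS EL => x ELx xT.
rewrite ELx; last by move: xT; rewrite /torus /= !in_itv/=; lra.
rewrite /torus_translation; set y := x - m.
by rewrite -[RHS](pf _ (Num.floor y)) addrAC fracK subrK.
Qed.
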